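(* Let $n \in \mathbb{N}$, $n \geq 2$, be arbitrary and let $\mathcal{O}_{n}$ be the monoid of order-preserving transformations on $\{1,\ldots,n\}$ with the usual order. Then the maximal subsemigroups of $\mathcal{O}_{n}$ are precisely: (a) $\mathcal{O}_{n} \setminus \{\mathrm{id}_{n}\}$ (type (M1)); (b) the union of $\mathcal{O}_{n} \setminus J_{n - 1}$ and the union of the Green's classes in $$\{ L_{(i + 1) / 2} \cap \mathcal{O}_{n} : i \in A,\ i\ \text{is odd}\} \cup \{ R_{\{ i / 2, (i / 2) + 1\}} \cap \mathcal{O}_{n} : i \in A,\ i\ \text{is even}\},$$ where $A$ is a maximal independent subset of the path graph of order $2n - 1$ that contains both odd and even numbers (type (M2)); (c) $\mathcal{O}_{n}\setminus L$, where $L$ is any $\mathscr{L}$-class in $J_{n - 1} \cap \mathcal{O}_{n}$ (type (M3)); and (d) $\mathcal{O}_{n}\setminus R_{\{i, i + 1\}}$, where $i \in \{2, \ldots, n - 2\}$ (type (M4)). In particular, there are $3$ maximal subsemigroups of $\mathcal{O}_{2}$, and for $n \geq 3$, there are $A_{2n - 1} + 2n - 4$ maximal subsemigroups of $\mathcal{O}_{n}$, where $A_{2n - 1}$ is the $(2n - 1)^{\text{th}}$ term of the sequence defined by $A_{1} = 1$, $A_{2} = A_{3} = 2$, and $A_{k} = A_{k - 2} + A_{k - 3}$ for $k \geq 4$.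
   Context: $\mathbb{N}=\{1,2,3,\ldots\}$. A maximal subsemigroup of a semigroup $S$ is a proper subsemigroup not contained in any other proper subsemigroup of $S$. $\mathcal{PT}_n$ is the monoid of all partial maps from $\{1,\ldots,n\}$ to itself under composition; $\mathrm{id}_n$ is its identity. A transformation is an element with domain $\{1,\ldots,n\}$; it is order-preserving if $1\alpha\le 2\alpha\le\cdots\le n\alpha$ (maps written on the right). $\operatorname{rank}(\alpha)=|\operatorname{im}(\alpha)|$ and $\ker(\alpha)=\{(i,j): i\alpha=j\alpha\}$ on $\operatorname{dom}(\alpha)$. Define $J_{n-1}=\{\alpha\in\mathcal{PT}_n:\operatorname{rank}(\alpha)=n-1\}$ and, for distinct $i,j$: $L_i=\{\alpha\in J_{n-1}: i\notin\operatorname{im}(\alpha)\}$, $R_{\{i,j\}}=\{\alpha\in J_{n-1}:(i,j)\in\ker(\alpha)\}$. The $\mathscr{L}$-classes of $J_{n-1}\cap\mathcal{O}_n$ are the sets $L_i\cap\mathcal{O}_n$ ($1\le i\le n$) and its $\mathscr{R}$-classes are the sets $R_{\{i,i+1\}}\cap\mathcal{O}_n$ ($1\le i\le n-1$). The path graph of order $k$ has vertices $\{1,\ldots,k\}$ and edges $\{i,i+1\}$ for $1\le i\le k-1$. An independent subset of a graph is a set of vertices no two of which are adjacent; it is maximal if it is contained in no other independent subset. Types: a maximal subsemigroup $M$ of a finite monoid $S$ arises from the $\mathscr{J}$-class $J$ if $S\setminus M\subseteq J$; when $J$ is regular, $M$ has type (M1) if $M\cap J=\varnothing$; (M2) if $M\cap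 J$ is a non-empty union of both $\mathscr{L}$- and $\mathscr{R}$-classes of $J$ (those in a non-empty proper subset of the $\mathscr{L}$-classes together with those in a non-empty proper subset of the $\mathscr{R}$-classes); (M3) if $M\cap J$ is a non-empty union of $\mathscr{L}$-classes; (M4) if $M\cap J$ is a non-empty union of $\mathscr{R}$-classes; (M5) if $M\cap J$ meets every $\mathscr{H}$-class of $J$. *)

(* Defs.v *)
From HB Require Import structures.
From mathcomp Require Import all_boot.

Set Implicit Arguments.
Unset Strict Implicit.
Unset Printing Implicit Defensive.

#[short(type="finMonoidType")]
HB.structure Definition FinMonoid := {T of Monoid T & Finite T}.

(* In this section S is a submonoid of the finite monoid T, given as a set;   *)
(* ideals, hence Green's relations, are relative to S and not to T. As S      *)
(* contains 1, adjoining an identity (S^1) is not needed.                     *)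
Section Semigroups.

Variable T : finMonoidType.
Implicit Types (S M J : {set T}) (x y : T).

Definition subsemigroup S M :=
  (M \subset S) && [forall x in M, forall y in M, (x * y)%g \in M].

Definition maximal_subsemigroup S M :=
  maxset (fun N => subsemigroup S N && (N \proper S)) M.

Definition left_ideal S x : {set T} := [set (s * x)%g | s in S].
Definition right_ideal S x : {set T} := [set (x * s)%g | s in S].
Definition two_sided_ideal S x : {set T} :=
  [set (s * x * t)%g | s in S, t in S].

Definition Lclass S x : {set T} :=
  [set y in S | left_ideal S x == left_ideal S y].
Definition Rclass S x : {set T} :=
  [set y in S | right_ideal S x == right_ideal S y].
Definition Jclass S x : {set T} :=
  [set y in S | two_sided_ideal S x == two_sided_ideal S y].

Definition Lclasses S J : {set {set T}} := [set Lclass S x | x in J].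
Definition Rclasses S J : {set {set T}} := [set Rclass S x | x in J].
Definition Jclasses S : {set {set T}} := [set Jclass S x | x in S].

Definition regular S J :=
  [forall x in J, exists y in S, (x * y * x)%g == x].

Definition arises_from S M J :=
  (J \in Jclasses S) && (S :\: M \subset J).

Definition type_M1 S M : Prop :=
  exists J, [/\ arises_from S M J, regular S J & M :&: J = set0].

Definition type_M2 S M : Prop :=
  exists J, [/\ arises_from S M J, regular S J &
    exists X Y : {set {set T}},
      [/\ X != set0, X \proper Lclasses S J,
          Y != set0, Y \proper Rclasses S J
        & M :&: J = cover X :|: cover Y]].

Definition type_M3 S M : Prop :=
  exists J, [/\ arises_from S M J, regular S J, M :&: J != set0 &
    exists2 X : {set {set T}}, X \subset Lclasses S J & M :&: J = cover X].

Definition type_M4 S M : Prop :=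
  exists J, [/\ arises_from S M J, regular S J, M :&: J != set0 &
    exists2 Y : {set {set T}}, Y \subset Rclasses S J & M :&: J = cover Y].

End Semigroups.

(* The set {1, ..., n} is represented by 'I_n, with x : 'I_n standing for the *)
(* number label x, so that all explicit indices below are 1-based.            *)
Definition label n (x : 'I_n) : nat := x.+1.

(* a x = None means that the partial map a is undefined at x. *)
Definition PT (n : nat) : Type := {ffun 'I_n -> option 'I_n}.

HB.instance Definition _ n := Finite.copy (PT n) {ffun 'I_n -> option 'I_n}.

Section PartialTransformations.

Variable n : nat.
Implicit Types (a b c : PT n) (x y : 'I_n).

(* Maps act on the right: x (a b) = (x a) b. *)
Definition pt_mul a b : PT n := [ffun x => obind b (a x)].
Definition pt_id : PT n := [ffun x => Some x].

Lemma pt_mulA : associative pt_mul.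
Proof.
move=> a b c; apply/ffunP => x; rewrite !ffunE.
by case: (a x) => //= y; rewrite ffunE.
Qed.

Lemma pt_mul1p : left_id pt_id pt_mul.
Proof. by move=> a; apply/ffunP => x; rewrite !ffunE. Qed.

Lemma pt_mulp1 : right_id pt_id pt_mul.
Proof.
move=> a; apply/ffunP => x; rewrite !ffunE.
by case: (a x) => //= y; rewrite ffunE.
Qed.

HB.instance Definition _ := isMonoid.Build (PT n) pt_mulA pt_mul1p pt_mulp1.

Definition dom a : {set 'I_n} := [set x | a x != None].
Definition im a : {set 'I_n} := [set y | [exists x, a x == Some y]].
Definition rank a := #|im a|.
Definition ker a : rel 'I_n :=
  [rel x y | [&& x \in dom a, y \in dom a & a x == a y]].

Definition order_preserving a :=
  [forall x : 'I_n, forall y : 'I_n, forall u : 'I_n, forall v : 'I_n,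
    [&& x <= y, a x == Some u & a y == Some v] ==> (u <= v)].

Definition On : {set PT n} := [set a | (dom a == setT) && order_preserving a].

(* J_{n-1} *)
Definition Jn1 : {set PT n} := [set a | rank a == n - 1].

(* L_i *)
Definition L (i : nat) : {set PT n} :=
  [set a in Jn1 | i \notin [seq label y | y in im a]].

(* R_{i,j} *)
Definition R (i j : nat) : {set PT n} :=
  [set a in Jn1 |
    [exists x, exists y, [&& label x == i, label y == j & ker a x y]]].

End PartialTransformations.

Arguments On : clear implicits.
Arguments Jn1 : clear implicits.
Arguments L : clear implicits.
Arguments R : clear implicits.
Arguments pt_id : clear implicits.

Section Graphs.

Definition independent (V : finType) (e : rel V) (A : {set V}) :=
  [forall v in A, forall w in A, (v != w) ==> ~~ e v w].

Definition maximal_independent (V : finType) (e : rel V) (A : {set V}) :=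
  maxset (independent e) A.

Definition path_graph (k : nat) : rel 'I_k :=
  [rel v w | (label w == label v + 1) || (label v == label w + 1)].

End Graphs.

Definition has_both_parities k (A : {set 'I_k}) :=
  [exists v in A, odd (label v)] && [exists v in A, ~~ odd (label v)].

Definition independent_subsemigroup n (A : {set 'I_(2 * n - 1)}) : {set PT n} :=
  (On n :\: Jn1 n)
  :|: ((\bigcup_(v in A | odd (label v)) (L n ((label v + 1) %/ 2) :&: On n))
       :|: (\bigcup_(v in A | ~~ odd (label v))
              (R n (label v %/ 2) (label v %/ 2 + 1) :&: On n))).

Section Families.

Variables (n : nat) (M : {set PT n}).

Definition family_a : Prop := M = On n :\ pt_id n.

Definition family_b : Prop :=
  exists A : {set 'I_(2 * n - 1)},
    [/\ maximal_independent (@path_graph (2 * n - 1)) A,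
        has_both_parities A & M = independent_subsemigroup A].

Definition family_c : Prop :=
  exists2 K : {set PT n},
    K \in Lclasses (On n) (Jn1 n :&: On n) & M = On n :\: K.

Definition family_d : Prop :=
  exists2 i : nat, 2 <= i <= n - 2 & M = On n :\: R n i (i + 1).

End Families.

(* The sequence is only meant for k >= 1; the value at 0 is never used, since *)
(* Aseq k = Aseq (k - 2) + Aseq (k - 3) is applied for k >= 4 only.           *)
Fixpoint Aseq (k : nat) : nat :=
  match k with
  | 0 => 0
  | 1 => 1
  | 2 => 2
  | 3 => 2
  | ((k3.+1) as k2).+2 => Aseq k2 + Aseq k3
  end.

(* Main.v *)
Require Import Defs.
From mathcomp Require Import all_boot.
From mathcomp Require Import zify.

(** Points are numbered from 0 throughout the lemmas. For [i + 1 < n] and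
    [j < n] let [fold_skip i j] be the order-preserving map whose only kernel
    pair is [{i, i+1}] and whose image misses exactly [j].

    Every [a <> 1] in [O_n] factors as [fold_skip i j * b] with [b] in [O_n] and
    [rank b = rank a + 1] ([On_factorization]): collapse a kernel pair of [a],
    then insert a missed value. Hence the maps [fold_skip i j] are exactly the
    elements of rank [n - 1] of [O_n], and together with 1 they generate [O_n].
    Moreover [fold_skip i j * fold_skip k l] equals [fold_skip i l] when [j] is
    [k] or [k + 1], and has smaller rank otherwise.

    Consequently a maximal subsemigroup other than [O_n] minus 1 contains 1 and
    all maps of rank at most [n - 2], and is determined by the set X of pairs
    [(i, j)] with [fold_skip i j] in it; X has to be closed under the partial
    product above. Put the [L]-class missing [j] at vertex [2j] and the
    [R]-class folding [i] at vertex [2i + 1] of a path with [2n - 1] vertices,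
    so that the product is nonzero exactly for adjacent classes. If
    [(i0, j0)] is not in X, let A consist of the [L]-vertices [l] with
    [(i0, l)] in X and the [R]-vertices that are neither [i0] nor adjacent to
    such an [l]. Then A is independent and X lies in the set of all pairs with
    [L]-class or [R]-class in A ([subsemigroup_sub_indep]). The assignment from
    A to the corresponding subsemigroup reflects inclusion, provided that A
    contains neither all [L]-vertices nor all [R]-vertices. So the maximal
    subsemigroups containing 1 correspond bijectively to the maximal members
    among these independent sets ([maximal_subsemigroupE]).

    Finally ([maxset_proper_indepP]) such a set is either a maximal independent
    set with vertices of both kinds, or all [L]-vertices but one, or all
    [R]-vertices but one which is not next to an end of the path (removing that
    one would make room for the end vertex). The maximal independent sets of a
    path satisfy the Padovan recurrence, according to whether they contain the
    first or the second vertex, and exactly two of them lack one of the two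
    kinds; this gives the number of maximal subsemigroups. *)

Set Implicit Arguments.
Unset Strict Implicit.
Unset Printing Implicit Defensive.

(** * Order-preserving maps and the factorization of elements *)

Section OrderPreserving.
Variable n : nat.
Implicit Types (a b : PT n) (i j k l : nat).

(** The value of [a] at [k], as a natural number; 0 where [a] is undefined or
    [k] is not a point. *)
Definition app a k : nat := odflt 0 (omap val (obind a (insub k))).

(** The partial map induced by a function on numbers, undefined where the value
    is not below [n]. *)
Definition of_natfun (f : nat -> nat) : PT n := [ffun x : 'I_n => insub (f x)].

Lemma appE a (x : 'I_n) y : a x = Some y -> app a x = y.
Proof. by rewrite /app valK /= => ->. Qed.

Lemma OnP a :
  reflect ((forall x, a x != None) /\
           (forall x y : 'I_n, x <= y -> app a x <= app a y)) (a \in On n).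
Proof.
rewrite inE; apply: (iffP andP) => [[/eqP da /forallP oa]|[da oa]].
  have tot x : a x != None by move/setP/(_ x): da; rewrite !inE.
  split=> // x y xy; move: (tot x) (tot y).
  case ax: (a x) => [u|//] _; case ay: (a y) => [v|//] _.
  rewrite (appE ax) (appE ay).
  move: (oa x) => /forallP/(_ y)/forallP/(_ u)/forallP/(_ v).
  by rewrite ax ay !eqxx !andbT xy.
split; first by apply/eqP/setP=> x; rewrite !inE da.
apply/forallP => x; apply/forallP => y; apply/forallP => u; apply/forallP => v.
apply/implyP=> /and3P[xy /eqP/appE<- /eqP/appE<-]; exact: oa.
Qed.

Lemma app_some a (x : 'I_n) : a \in On n -> exists2 y, a x = Some y & app a x = y.
Proof.
by move/OnP=> [/(_ x)]; case ax: (a x) => [y|//] _ _; exists y => //; exact: appE.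
Qed.

Lemma app_lt a k : a \in On n -> k < n -> app a k < n.
Proof. by move=> aO kn; have [y _ /= ->] := app_some (Ordinal kn) aO. Qed.

Lemma app_mono a k l : a \in On n -> k <= l -> l < n -> app a k <= app a l.
Proof.
move=> /OnP[_ oa] kl ln; exact: (oa (Ordinal (leq_ltn_trans kl ln)) (Ordinal ln)).
Qed.

Lemma On_ext a b : a \in On n -> b \in On n ->
  (forall k, k < n -> app a k = app b k) -> a = b.
Proof.
move=> aO bO ab; apply/ffunP => x.
have [u -> eu] := app_some x aO; have [v -> ev] := app_some x bO.
by congr Some; apply: val_inj; rewrite /= -eu -ev ab.
Qed.

Lemma app_of_natfun f k : k < n -> f k < n -> app (of_natfun f) k = f k.
Proof. by move=> kn fn; rewrite /app insubT /= ffunE /= insubT. Qed.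

Lemma of_natfun_On f : (forall k, k < n -> f k < n) ->
  (forall k l, k <= l -> l < n -> f k <= f l) -> of_natfun f \in On n.
Proof.
move=> fn fm; apply/OnP; split=> [x|x y xy].
  by rewrite ffunE insubT ?fn.
by rewrite !app_of_natfun ?fn // fm.
Qed.

Lemma app_mul a b k : a \in On n -> k < n -> app (a * b)%g k = app b (app a k).
Proof.
move=> aO kn; have [y ay /= ->] := app_some (Ordinal kn) aO.
by rewrite /app insubT /= valK ffunE /= -[Sub k kn]/(Ordinal kn) ay.
Qed.

Lemma app1 k : k < n -> app 1%g k = k.
Proof. by move=> kn; rewrite /app insubT /= ffunE. Qed.

Lemma On1 : 1%g \in On n.
Proof. by apply/OnP; split=> [x|x y xy]; rewrite ?ffunE // !app1. Qed.

Lemma OnM a b : a \in On n -> b \in On n -> (a * b)%g \in On n.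
Proof.
move=> aO bO; apply/OnP; split=> [x|x y xy].
  by rewrite ffunE; have [y -> _] := app_some x aO; have [z /= ->] := app_some y bO.
by rewrite !app_mul // app_mono ?app_lt // app_mono.
Qed.

Lemma imP a (y : 'I_n) : a \in On n ->
  reflect (exists2 k, k < n & app a k = y) (y \in im a).
Proof.
move=> aO; rewrite inE; apply: (iffP existsP) => [[x /eqP ax]|[k kn ak]].
  by exists x => //; exact: appE.
exists (Ordinal kn); have [z -> e] := app_some (Ordinal kn) aO.
by apply/eqP; congr Some; apply: val_inj; rewrite /= -e.
Qed.

Lemma rank_le a : rank a <= n.
Proof. by rewrite -[leqRHS]card_ord; exact: max_card. Qed.

Lemma rank_mulr a b : rank (a * b)%g <= rank b.
Proof.
apply: subset_leq_card; apply/subsetP => y; rewrite !inE => /existsP[x].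
by rewrite ffunE; case: (a x) => //= z bz; apply/existsP; exists z.
Qed.

Lemma rank_mull a b : rank (a * b)%g <= rank a.
Proof.
case: (posnP n) => [n0|n0].
  by apply: leq_trans (rank_le _) _; rewrite [leqLHS]n0.
pose x0 := Ordinal n0.
suff h : im (a * b)%g \subset [set odflt x0 (b y) | y in im a].
  exact: leq_trans (subset_leq_card h) (leq_imset_card _ _).
apply/subsetP => y; rewrite inE => /existsP[x]; rewrite ffunE.
case ax: (a x) => [z|//] /= /eqP bz; apply/imsetP; exists z; last by rewrite bz.
by rewrite inE; apply/existsP; exists x; rewrite ax.
Qed.

(** For [i + 1 < n] and [j < n], the order-preserving map identifying only [i]
    and [i + 1], whose image is everything but [j]: [unbump i] collapses the pair
    and [bump j] leaves out [j]. *)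
Definition fold_skip i j : PT n := of_natfun (fun x => bump j (unbump i x)).

Lemma fold_skip_On i j : i.+1 < n -> j < n -> fold_skip i j \in On n.
Proof. by move=> hi hj; apply: of_natfun_On => [k|k l]; rewrite /bump /unbump; lia. Qed.

Lemma app_fold_skip i j k : i.+1 < n -> j < n -> k < n ->
  app (fold_skip i j) k = bump j (unbump i k).
Proof. by move=> hi hj hk; rewrite app_of_natfun //; rewrite /bump /unbump; lia. Qed.

Lemma im_fold_skip i j (hj : j < n) : i.+1 < n -> im (fold_skip i j) = ~: [set
  Ordinal hj].
Proof.
move=> hi; apply/setP => y; rewrite in_setC1.
apply/imP/idP => [|[k kn]|yj]; first exact: fold_skip_On.
  by rewrite app_fold_skip // => e; rewrite -val_eqE /= -e eq_sym; exact: neq_bump.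
have yj' : (y : nat) != j by [].
exists (bump i (unbump j y)); first by have := ltn_ord y; rewrite /bump /unbump; lia.
rewrite app_fold_skip //; first by rewrite bumpK unbumpK.
by have := ltn_ord y; rewrite /bump /unbump; lia.
Qed.

Lemma rank_fold_skip i j : i.+1 < n -> j < n -> rank (fold_skip i j) = n - 1.
Proof. by move=> hi hj; rewrite /rank (im_fold_skip hj hi) cardsC1 card_ord subn1. Qed.

Lemma ker_fold_skip i j k l : i.+1 < n -> j < n -> k < l -> l < n ->
  app (fold_skip i j) k = app (fold_skip i j) l -> k = i /\ l = i.+1.
Proof. by move=> hi hj kl ln; rewrite !app_fold_skip //; rewrite /bump /unbump; lia. Qed.

Lemma fold_skip_fold i j : i.+1 < n -> j < n -> app (fold_skip i j) i = app
  (fold_skip i j) i.+1.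
Proof. by move=> hi hj; rewrite !app_fold_skip //; rewrite /bump /unbump; lia. Qed.

Lemma fold_skip_miss i j k : i.+1 < n -> j < n -> k < n -> app (fold_skip i j) k != j.
Proof. by move=> hi hj hk; rewrite app_fold_skip // eq_sym neq_bump. Qed.

Lemma fold_skip_hit i j k : i.+1 < n -> j < n -> k < n -> k != j ->
  exists2 x, x < n & app (fold_skip i j) x = k.
Proof.
move=> hi hj hk kj; apply: (imP (Ordinal hk) (fold_skip_On hi hj)).
by rewrite (im_fold_skip hj hi) !inE -val_eqE.
Qed.

Lemma fold_skip_inj i j i' j' : i.+1 < n -> j < n -> i'.+1 < n -> j' < n ->
  fold_skip i j = fold_skip i' j' -> i = i' /\ j = j'.
Proof.
move=> hi hj hi' hj' e; split.
  by apply: (proj1 (ker_fold_skip hi' hj' (ltnSn i) hi _)); rewrite -e fold_skip_fold.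
apply/eqP; apply/negPn/negP => jj'.
have [x xn] := fold_skip_hit hi' hj' hj jj'.
by rewrite -e => /eqP; apply/negP; exact: fold_skip_miss.
Qed.

Lemma fold_skip_mul i j k l : i.+1 < n -> j < n -> k.+1 < n -> l < n ->
  (j == k) || (j == k.+1) -> (fold_skip i j * fold_skip k l)%g = fold_skip i l.
Proof.
move=> hi hj hk hl jk; apply: On_ext; rewrite ?OnM ?fold_skip_On // => x xn.
rewrite app_mul ?fold_skip_On // !app_fold_skip //; last by rewrite /bump /unbump; lia.
by rewrite /bump /unbump; lia.
Qed.

(** If [j] is neither [k] nor [k + 1], then [k] and [k + 1] are both attained by
    the first factor and identified by the second, which gives the product a
    second kernel pair. *)
Lemma fold_skip_mul_J i j k l i' j' : i.+1 < n -> j < n -> k.+1 < n -> l < n ->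
  i'.+1 < n -> j' < n ->
  (fold_skip i j * fold_skip k l)%g = fold_skip i' j' -> (j == k) || (j == k.+1).
Proof.
move=> hi hj hk hl hi' hj' e; apply/negPn/negP; rewrite negb_or => /andP[jk jk1].
have EO := fold_skip_On hi hj.
have ii' : i = i'.
  apply: (proj1 (ker_fold_skip hi' hj' (ltnSn i) hi _)).
  by rewrite -e !app_mul ?fold_skip_fold //; lia.
rewrite eq_sym in jk; rewrite eq_sym in jk1.
have [u un eu] := fold_skip_hit hi hj (ltnW hk) jk.
have [v vn ev] := fold_skip_hit hi hj hk jk1.
have uv : u < v.
  by rewrite ltnNge; apply/negP => /(app_mono EO)/(_ un); rewrite eu ev ltnn.
have [|ui vi] := ker_fold_skip hi' hj' uv vn.
  by rewrite -e !app_mul // eu ev fold_skip_fold.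
by move: eu ev; rewrite ui vi -ii' (fold_skip_fold hi hj) => ->; lia.
Qed.

(** An order-preserving map without an adjacent kernel pair is strictly
    increasing, hence the identity. *)
Lemma On_collapse a : a \in On n -> a != 1%g ->
  exists2 i, i.+1 < n & app a i = app a i.+1.
Proof.
move=> aO a1.
have [/existsP[[i hi] /= /andP[hi' /eqP e]]|/existsPn h] :=
  boolP [exists i : 'I_n, (i.+1 < n) && (app a i == app a i.+1)]; first by exists i.
have lt k : k.+1 < n -> app a k < app a k.+1.
  move=> kn; rewrite ltn_neqAle app_mono // andbT.
  by have := h (Ordinal (ltnW kn)); rewrite /= kn.
have up k : k < n -> k <= app a k.
  elim: k => // k IH kn; exact: leq_ltn_trans (IH (ltnW kn)) (lt _ kn).
(* Strict growth bounds the values from above, counting down from [n]. *)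
have dn d k : k + d.+1 = n -> app a k + d < n.
  elim: d k => [|d IH] k e; first by rewrite addn0 app_lt //; lia.
  by have := lt k; have := IH k.+1; lia.
case/eqP: a1; apply: On_ext => // [|k kn]; first exact: On1.
by rewrite app1 //; have := up k kn; have := dn (n - k.+1) k; lia.
Qed.

Lemma On_missed a : a \in On n -> a != 1%g -> exists y, y \notin im a.
Proof.
move=> aO a1; have [i hi e] := On_collapse aO a1.
apply/existsP; rewrite -negb_forall; apply/negP => /forallP sur.
pose f (x : 'I_n) : 'I_n := Ordinal (app_lt aO (ltn_ord x)).
suff fi : injective f.
  have : Ordinal (ltnW hi) = Ordinal hi by apply: fi; apply: val_inj.
  by move/(congr1 val) => /=; lia.
suff /imset_injP fi : #|f @: 'I_n| == #|'I_n| by move=> x y; apply: fi.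
rewrite -cardsT; apply/eqP/eq_card => y; rewrite inE.
have /imP[//|k kn ak] := sur y.
by apply/imsetP; exists (Ordinal kn) => //; apply: val_inj; rewrite /= ak.
Qed.

Lemma On_factorization a : a \in On n -> a != 1%g ->
  exists i j b, [/\ i.+1 < n, j < n, b \in On n, rank b = (rank a).+1
                  & a = (fold_skip i j * b)%g].
Proof.
move=> aO a1; have [i hi ei] := On_collapse aO a1.
have [m ma] := On_missed aO a1.
(* [c] is [a] with the repeated value at [i] listed once; its length is
   [n - 1]. *)
pose c k := app a (bump i k).
have cn k : k < n.-1 -> c k < n by move=> kn; apply: app_lt => //; rewrite /bump; lia.
have cmono k l : k <= l -> l < n.-1 -> c k <= c l.
  by move=> kl ln; apply: app_mono => //; rewrite /bump; lia.
have am k : k < n -> app a k != m.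
  by move=> kn; apply: contraNneq ma => e; apply/imP => //; exists k.
have cm k : k < n.-1 -> c k != m by move=> kn; apply: am; rewrite /bump; lia.
(* [j] is the position at which [m] has to be inserted to keep [c] sorted. *)
have exj : exists j, (j == n.-1) || (m < c j) by exists n.-1; rewrite eqxx.
case: (ex_minnP exj) => j jP jmin.
have jn : j < n by have := jmin n.-1; rewrite eqxx => /(_ isT); lia.
have c_lt k : k < j -> c k < m.
  move=> kj; have := jmin k; have := cm k.
  by case: (ltngtP (c k) m) => //; lia.
have c_gt k : j <= k -> k < n.-1 -> m < c k.
  move=> jk kn; case/orP: jP => [|h]; first lia.
  exact: leq_trans h (cmono _ _ jk kn).
pose f x := if x == j then m : nat else c (unbump j x).
have fn k : k < n -> f k < n.
  by rewrite /f; case: eqP => // kj kn; apply: cn; rewrite /unbump; lia.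
have bO : of_natfun f \in On n.
  apply: of_natfun_On => // k l kl ln; rewrite /f.
  case: eqP => kj; case: eqP => lj //; first by apply: ltnW; apply: c_gt;
    rewrite /unbump; lia.
    by apply: ltnW; apply: c_lt; rewrite /unbump; lia.
  by apply: cmono; rewrite /unbump; lia.
have fac : a = (fold_skip i j * of_natfun f)%g.
  apply: On_ext; rewrite ?OnM ?fold_skip_On // => x xn.
  have ux : unbump i x < n.-1 by rewrite /unbump; lia.
  rewrite app_mul ?fold_skip_On // app_fold_skip // app_of_natfun //;
    last by apply: fn; rewrite /bump; lia.
    rewrite /f eq_sym (negbTE (neq_bump _ _)) bumpK /c unbumpKcond.
    by case: eqP => [->|].
  by rewrite /bump; lia.
exists i, j, (of_natfun f); split=> //.
suff imb : im (of_natfun f) = m |: im a by rewrite /rank imb cardsU1 ma.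
apply/setP => y; rewrite in_setU1.
apply/imP/orP => // [[k kn]|[/eqP->|/imP[//|k kn <-]]].
- rewrite app_of_natfun ?fn // /f; case: eqP => [_ e|kj e]; first by left;
  apply/eqP/val_inj.
  by right; apply/imP => //; exists (bump i (unbump j k)) => //; rewrite /bump /unbump;
    lia.
- by exists j; rewrite // app_of_natfun ?fn // /f eqxx.
- exists (app (fold_skip i j) k); first by rewrite app_lt // fold_skip_On.
  by rewrite [in RHS]fac app_mul // fold_skip_On.
Qed.

Lemma rank_eq1 a : a \in On n -> rank a = n -> a = 1%g.
Proof.
move=> aO ra; apply/eqP/negPn/negP => a1.
have [i [j [b [_ _ _ rb _]]]] := On_factorization aO a1.
by have := rank_le b; rewrite rb ra ltnn.
Qed.

Lemma rank1 : rank (1%g : PT n) = n.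
Proof.
rewrite -[RHS]card_ord -[RHS]cardsT; apply: eq_card => y; rewrite in_setT.
by apply/imP; [exact: On1 | exists y; rewrite ?app1].
Qed.

Lemma Jn1_fold_skip a : a \in On n -> a \in Jn1 n -> 0 < n ->
  exists i j, [/\ i.+1 < n, j < n & a = fold_skip i j].
Proof.
move=> aO; rewrite inE => /eqP ra n0.
have a1 : a != 1%g by apply/eqP => a1; move: ra; rewrite a1 rank1; lia.
have [i [j [b [hi hj bO rb ->]]]] := On_factorization aO a1.
exists i, j; split=> //; rewrite (rank_eq1 bO) ?mulg1 //; lia.
Qed.

(** [O_n] is generated by 1 and its elements of rank [n - 1]. *)
Lemma On_generated (M : {set PT n}) : 
  (forall i j, i.+1 < n -> j < n -> fold_skip i j \in M) -> 1%g \in M ->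
  {in M &, forall x y, (x * y)%g \in M} -> On n \subset M.
Proof.
move=> ME M1 MM; apply/subsetP => a.
have [d] := ubnP (n - rank a); elim: d a => // d IH a ad aO.
have [->//|a1] := eqVneq a 1%g.
have [i [j [b [hi hj bO rb ->]]]] := On_factorization aO a1.
apply: MM; first exact: ME.
by apply: IH => //; have := rank_le b; lia.
Qed.

End OrderPreserving.

(** * Green's classes of the elements of rank n - 1 *)

Section Green.
Variable n : nat.
Hypothesis hn : 2 <= n.
Implicit Types (a b : PT n) (i j k l : nat).

(** The elements of rank [n - 1]; each of the Green's classes [L] and [R] fixes
    one of the two parameters. *)
Lemma Jn1_OnP a : reflect (exists i j, [/\ i.+1 < n, j < n & a = fold_skip n i j])
                      (a \in Jn1 n :&: On n).
Proof.
apply: (iffP setIP) => [[aJ aO]|[i [j [hi hj ->]]]];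
  first by apply: Jn1_fold_skip => //; lia.
by rewrite fold_skip_On // inE rank_fold_skip.
Qed.

Lemma L_OnP j a : j < n ->
  reflect (exists2 i, i.+1 < n & a = fold_skip n i j) (a \in L n j.+1 :&: On n).
Proof.
move=> hj; rewrite /L setIdE setIAC in_setI.
apply: (iffP andP) => [[/Jn1_OnP[i [j' [hi hj' ea]]] jm]|[i hi ->]].
  exists i => //; rewrite ea; suff <- : j = j' by [].
  apply/eqP/negPn/negP => jj'; move: jm; rewrite inE; case/negP.
  apply/imageP; exists (Ordinal hj) => //=.
  by rewrite ea (im_fold_skip hj' hi) !inE -val_eqE.
split; first by apply/Jn1_OnP; exists i, j.
rewrite inE; apply/negP => /imageP[y]; rewrite (im_fold_skip hj hi) !inE -val_eqE /=.
by move=> /eqP yj [/esym].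
Qed.

Lemma R_OnP i a : i.+1 < n ->
  reflect (exists2 j, j < n & a = fold_skip n i j) (a \in R n i.+1 i.+2 :&: On n).
Proof.
move=> hi; rewrite /R setIdE setIAC in_setI.
apply: (iffP andP) => [[/Jn1_OnP[i' [j [hi' hj ea]]]]|[j hj ->]].
  rewrite inE => /existsP[x /existsP[y /and3P[/eqP[xi] /eqP[yi] /and3P[_ _ /eqP axy]]]].
  exists j => //; rewrite ea; suff -> : i = i' by [].
  apply: (proj1 (ker_fold_skip hi' hj (ltnSn i) hi _)).
  by rewrite -ea -yi -xi /app !valK /= axy.
split; first by apply/Jn1_OnP; exists i, j.
rewrite inE; apply/existsP; exists (Ordinal (ltnW hi)).
apply/existsP; exists (Ordinal hi); rewrite /label /= !eqxx !andTb.
have EO := fold_skip_On hi hj.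
have [u eu au] := app_some (Ordinal (ltnW hi)) EO.
have [v ev av] := app_some (Ordinal hi) EO.
rewrite /ker /relpre /= /dom !in_set eu ev /=; apply/eqP; congr Some; apply: val_inj.
by rewrite /= -au -av /= fold_skip_fold.
Qed.

Lemma mem_left_ideal a : a \in On n -> a \in left_ideal (On n) a.
Proof. by move=> aO; apply/imsetP; exists 1%g; rewrite ?On1 ?mul1g. Qed.

Lemma mem_right_ideal a : a \in On n -> a \in right_ideal (On n) a.
Proof. by move=> aO; apply/imsetP; exists 1%g; rewrite ?On1 ?mulg1. Qed.

Lemma left_ideal_sub x y s : s \in On n -> x = (s * y)%g ->
  left_ideal (On n) x \subset left_ideal (On n) y.
Proof.
move=> sO ->; apply/subsetP => _ /imsetP[t tO ->].
by apply/imsetP; exists (t * s)%g; rewrite ?OnM // mulgA.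
Qed.

Lemma right_ideal_sub x y s : s \in On n -> x = (y * s)%g ->
  right_ideal (On n) x \subset right_ideal (On n) y.
Proof.
move=> sO ->; apply/subsetP => _ /imsetP[t tO ->].
by apply/imsetP; exists (s * t)%g; rewrite ?OnM // mulgA.
Qed.

Lemma two_sided_ideal_sub x y s t : s \in On n -> t \in On n ->
  x = (s * y * t)%g ->
  two_sided_ideal (On n) x \subset two_sided_ideal (On n) y.
Proof.
move=> sO tO ->; apply/subsetP => _ /imset2P[u v uO vO ->].
by apply/imset2P; exists (u * s)%g (t * v)%g; rewrite ?OnM // !mulgA.
Qed.

Lemma two_sided_rank x y : x \in On n ->
  two_sided_ideal (On n) x = two_sided_ideal (On n) y -> rank x <= rank y.
Proof.
move=> xO e.
have : x \in two_sided_ideal (On n) y.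
  by rewrite -e; apply/imset2P; exists 1%g 1%g; rewrite ?On1 ?mul1g ?mulg1.
case/imset2P => s t _ _ ->.
exact: leq_trans (rank_mull _ _) (rank_mulr _ _).
Qed.

Lemma Lclass_fold_skip i j : i.+1 < n -> j < n -> Lclass (On n) (fold_skip n i j) = L
  n j.+1 :&: On n.
Proof.
move=> hi hj; apply/setP => y; rewrite inE.
apply/andP/(L_OnP _ hj) => [[yO /eqP e]|[i' hi' ->]].
  have /imsetP[s sO ey] : y \in left_ideal (On n) (fold_skip n i j).
    by rewrite e mem_left_ideal.
  have /imsetP[t tO eE] : fold_skip n i j \in left_ideal (On n) y.
    by rewrite -e mem_left_ideal // fold_skip_On.
  have yJ : y \in Jn1 n :&: On n.
    rewrite !in_setI yO andbT inE eqn_leq -(rank_fold_skip hi hj).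
    by rewrite [in X in X && _]ey [in X in _ && X]eE !rank_mulr.
  have /Jn1_OnP[i' [j' [hi' hj' e']]] := yJ.
  exists i' => //; rewrite e'; suff -> : j = j' by [].
  apply/eqP/negPn/negP => jj'.
  have [x xn] := fold_skip_hit hi' hj' hj jj'.
  by rewrite -e' ey app_mul // => /eqP; apply/negP/fold_skip_miss => //; exact: app_lt.
rewrite fold_skip_On //; split=> //; rewrite eqEsubset.
rewrite (@left_ideal_sub (fold_skip n i j) (fold_skip n i' j) (fold_skip n i i'))
  ?fold_skip_On ?fold_skip_mul ?eqxx //; try lia.
by rewrite (@left_ideal_sub (fold_skip n i' j) (fold_skip n i j) (fold_skip n i' i))
  ?fold_skip_On ?fold_skip_mul ?eqxx //; try lia.
Qed.

Lemma Rclass_fold_skip i j : i.+1 < n -> j < n ->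
  Rclass (On n) (fold_skip n i j) = R n i.+1 i.+2 :&: On n.
Proof.
move=> hi hj; apply/setP => y; rewrite inE.
apply/andP/(R_OnP _ hi) => [[yO /eqP e]|[j' hj' ->]].
  have /imsetP[s sO ey] : y \in right_ideal (On n) (fold_skip n i j).
    by rewrite e mem_right_ideal.
  have /imsetP[t tO eE] : fold_skip n i j \in right_ideal (On n) y.
    by rewrite -e mem_right_ideal // fold_skip_On.
  have yJ : y \in Jn1 n :&: On n.
    rewrite !in_setI yO andbT inE eqn_leq -(rank_fold_skip hi hj).
    by rewrite [in X in X && _]ey [in X in _ && X]eE !rank_mull.
  have /Jn1_OnP[i' [j' [hi' hj' e']]] := yJ.
  exists j' => //; rewrite e'; suff -> : i = i' by [].
  apply: (proj1 (ker_fold_skip hi' hj' (ltnSn i) hi _)).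
  by rewrite -e' ey !app_mul ?fold_skip_fold ?fold_skip_On //; lia.
have hk l : l < n -> exists k, [/\ k.+1 < n & (l == k) || (l == k.+1)].
  by move=> hl; exists (minn l n.-2); lia.
rewrite fold_skip_On //; split=> //; rewrite eqEsubset.
have [k [kn jk]] := hk j hj; have [k' [kn' jk']] := hk j' hj'.
rewrite (@right_ideal_sub (fold_skip n i j) (fold_skip n i j') (fold_skip n k' j))
  ?fold_skip_On ?fold_skip_mul ?eqxx //.
by rewrite (@right_ideal_sub (fold_skip n i j') (fold_skip n i j) (fold_skip n k j'))
  ?fold_skip_On ?fold_skip_mul ?eqxx.
Qed.

Lemma Jclass_fold_skip i j : i.+1 < n -> j < n -> Jclass (On n) (fold_skip n i j) =
  Jn1 n :&: On n.
Proof.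
move=> hi hj; apply/setP => y; rewrite inE.
apply/andP/idP => [[yO /eqP e]|/Jn1_OnP[i' [j' [hi' hj' ->]]]].
  rewrite !in_setI yO andbT inE eqn_leq -(rank_fold_skip hi hj).
  by rewrite !two_sided_rank ?fold_skip_On.
have sub i1 j1 i2 j2 : i1.+1 < n -> j1 < n -> i2.+1 < n -> j2 < n ->
    two_sided_ideal (On n) (fold_skip n i1 j1) \subset two_sided_ideal (On n)
      (fold_skip n i2 j2).
  move=> hi1 hj1 hi2 hj2.
  have hk : (minn j2 n.-2).+1 < n by lia.
  apply: (@two_sided_ideal_sub _ _ (fold_skip n i1 i2) (fold_skip n (minn j2 n.-2) j1)).
  - by rewrite fold_skip_On //; lia.
  - by rewrite fold_skip_On.
  - by rewrite !fold_skip_mul ?eqxx //; lia.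
by rewrite fold_skip_On // eqEsubset !sub.
Qed.

Lemma Jclass_id : Jclass (On n) 1%g = [set 1%g].
Proof.
apply/setP => y; rewrite in_set1 /Jclass in_set.
apply/andP/eqP => [[yO /eqP e]|->].
  apply: rank_eq1 => //; apply/eqP; rewrite eqn_leq rank_le /=.
  by rewrite -{1}(rank1 n) two_sided_rank // On1.
by rewrite eqxx On1.
Qed.

Lemma Jn1_On_regular : regular (On n) (Jn1 n :&: On n).
Proof.
apply/forall_inP => _ /Jn1_OnP[i [j [hi hj ->]]].
apply/exists_inP; exists (fold_skip n (minn j n.-2) i);
  first by rewrite fold_skip_On //; lia.
by rewrite !fold_skip_mul ?eqxx //; lia.
Qed.

Lemma Jn1_On_Jclass : Jn1 n :&: On n \in Jclasses (On n).
Proof.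
have h : 0.+1 < n by []; have h' : 0 < n by lia.
by apply/imsetP; exists (fold_skip n 0 0); rewrite ?fold_skip_On ?Jclass_fold_skip.
Qed.

End Green.

(** * Subsemigroups and independent sets of the path *)

Section Index.
Variable m : nat.
Implicit Types (A B : {set 'I_m}).

(** Membership of a natural number in a set of ordinals; false out of bounds,
    so that the last vertex of a path needs no special treatment. *)
Definition memn A k : bool := if insub k is Some v then v \in A else false.

Lemma memn_val A (v : 'I_m) : memn A v = (v \in A).
Proof. by rewrite /memn valK. Qed.

Lemma memn_lt A k : memn A k -> k < m.
Proof. by rewrite /memn; case: insubP. Qed.

Lemma memn_set (p : nat -> bool) k : memn [set v : 'I_m | p v] k = (k < m) && p k.
Proof.
by rewrite /memn; case: insubP => [v vm vk|/negbTE->] //; rewrite inE vk -vk ltn_ord.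
Qed.

Lemma memn_ext A B : (forall k, k < m -> memn A k = memn B k) -> A = B.
Proof. by move=> h; apply/setP => v; rewrite -!memn_val h. Qed.

Lemma memn_sub A B : reflect (forall k, memn A k -> memn B k) (A \subset B).
Proof.
apply: (iffP subsetP) => [h k kA|h v]; last by rewrite -!memn_val; exact: h.
have km := memn_lt kA.
by rewrite -[k]/(val (Ordinal km)) memn_val h // -memn_val.
Qed.

Lemma independentP A :
  reflect (forall k, ~~ (memn A k && memn A k.+1)) (independent (@path_graph m) A).
Proof.
apply: (iffP forall_inP) => [h k|h v vA].
  apply/negP => /andP[kA k1A]; have k1m := memn_lt k1A; have km := memn_lt kA.
  move: (h (Ordinal km)); rewrite -memn_val => /(_ kA)/forall_inP/(_ (Ordinal k1m)).
  rewrite -memn_val => /(_ k1A)/implyP; rewrite -val_eqE /path_graph /label /=.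
  by move=> /(_ ltac:(lia)); lia.
apply/forall_inP => w wA; apply/implyP => _; apply/negP => /orP[] /eqP;
  rewrite /label => e.
  have := h v; rewrite memn_val vA /= => /negP; apply.
  have -> : v.+1 = w by lia.
  by rewrite memn_val.
have := h w; rewrite memn_val wA /= => /negP; apply.
have -> : w.+1 = v by lia.
by rewrite memn_val.
Qed.

End Index.

Section Maximal.
Variable n : nat.
Hypothesis hn : 2 <= n.
Notation m := (2 * n - 1).
Implicit Types (a b : PT n) (i j k l : nat) (A B : {set 'I_m}) (M N : {set PT n}).

(** Independent sets of the path that miss some vertex of each parity. The
    vertex [2j] stands for the [L]-class missing [j], and the vertex [2i + 1] for
    the [R]-class folding [i] and [i + 1]. *)
Definition proper_indep A : bool :=
  [&& independent (@path_graph m) A,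
      [exists v : 'I_m, odd v && (v \notin A)]
    & [exists v : 'I_m, ~~ odd v && (v \notin A)]].

Lemma proper_indepP A : reflect
  [/\ forall k, ~~ (memn A k && memn A k.+1),
      exists2 i, i.+1 < n & ~~ memn A i.*2.+1
    & exists2 j, j < n & ~~ memn A j.*2] (proper_indep A).
Proof.
apply: (iffP and3P) => [[/independentP iA /existsP[v /andP[ov vA]] /existsP[w
  /andP[ow wA]]]|
                        [iA [i hi iN] [j hj jN]]].
  split=> //.
    exists v./2; first by have := ltn_ord v; lia.
    by have -> : v./2.*2.+1 = v; [lia | rewrite memn_val].
  exists w./2; first by have := ltn_ord w; lia.
  by have -> : w./2.*2 = w; [lia | rewrite memn_val].
split; first exact/independentP.
  have h : i.*2.+1 < m by lia.
  by apply/existsP; exists (Ordinal h); rewrite -memn_val /= iN odd_double.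
have h : j.*2 < m by lia.
by apply/existsP; exists (Ordinal h); rewrite -memn_val /= jN odd_double.
Qed.

Notation IS := (@independent_subsemigroup n).

(** The subsemigroup of [A] contains all elements of [O_n] of rank other than
    [n - 1], and [fold_skip i j] as soon as its [L]-class or its [R]-class
    belongs to [A]. *)
Lemma indep_subsemigroupP A a : reflect
  (a \in On n /\
   (a \in Jn1 n -> exists i j,
      [/\ i.+1 < n, j < n, a = fold_skip n i j & memn A j.*2 || memn A i.*2.+1]))
  (a \in IS A).
Proof.
rewrite /independent_subsemigroup in_setU in_setD in_setU.
apply: (iffP orP) => [[/andP[/negbTE-> ->]|/orP[]]|[aO]].
- by split.
- case/bigcupP => v /andP[vA ov].
  have hv : v./2 < n by have := ltn_ord v; lia.
  have -> : (label v + 1) %/ 2 = v./2.+1 by move: ov; rewrite /label; lia.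
  case/(L_OnP hn _ hv) => i hi ->; split; first exact: fold_skip_On.
  move=> _; exists i, v./2; split=> //.
  by have -> : v./2.*2 = v; [move: ov; rewrite /label; lia | rewrite memn_val vA].
- case/bigcupP => v /andP[vA ov].
  have hv : v./2.+1 < n by move: (ltn_ord v) ov; rewrite /label; lia.
  have -> : label v %/ 2 = v./2.+1 by move: ov; rewrite /label; lia.
  rewrite addn1; case/(R_OnP hn _ hv) => j hj ->; split; first exact: fold_skip_On.
  move=> _; exists v./2, j; split=> //.
  by have -> : v./2.*2.+1 = v; [move: ov; rewrite /label; lia | rewrite memn_val vA orbT].
- have [aJ|aJ] := boolP (a \in Jn1 n); last by left; rewrite aO.
  case=> // i [j [hi hj -> /orP[]]] h; right; apply/orP; [left|right].
    have jm := memn_lt h; apply/bigcupP; exists (Ordinal jm).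
      by rewrite -memn_val h /label /= odd_double.
    have -> : (label (Ordinal jm) + 1) %/ 2 = j.+1 by rewrite /label /=; lia.
    by apply/L_OnP => //; exists i.
  have im := memn_lt h; apply/bigcupP; exists (Ordinal im).
    by rewrite -memn_val h /label /= odd_double.
  have -> : label (Ordinal im) %/ 2 = i.+1 by rewrite /label /=; lia.
  by rewrite addn1; apply/R_OnP => //; exists j.
Qed.

Lemma fold_skip_indep A i j : i.+1 < n -> j < n ->
  (fold_skip n i j \in IS A) = memn A j.*2 || memn A i.*2.+1.
Proof.
move=> hi hj; apply/indep_subsemigroupP/idP => [[_]|h]; last first.
  by split; [exact: fold_skip_On | move=> _; exists i, j].
rewrite inE rank_fold_skip // eqxx => /(_ isT)[i' [j' [hi' hj' e]]].
by have [-> ->] := fold_skip_inj hi hj hi' hj' e.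
Qed.

Lemma indep_subsemigroup1 A : 1%g \in IS A.
Proof. by apply/indep_subsemigroupP; rewrite On1 inE rank1; split=> // /eqP; lia. Qed.

Lemma indep_subsemigroup_low A : On n :\: Jn1 n \subset IS A.
Proof. exact: subsetUl. Qed.

Lemma subsemigroupP (M : {set PT n}) :
  reflect (M \subset On n /\ {in M &, forall x y, (x * y)%g \in M})
          (subsemigroup (On n) M).
Proof.
apply: (iffP andP) => [[MO /forall_inP MM]|[MO MM]]; split=> //.
  by move=> x y xM yM; have /forall_inP := MM x xM; apply.
by apply/forall_inP => x xM; apply/forall_inP => y yM; apply: MM.
Qed.

Lemma Jn1_factors a b : a \in On n -> b \in On n -> (a * b)%g \in Jn1 n ->
  (a = 1%g \/ a \in Jn1 n) /\ (b = 1%g \/ b \in Jn1 n).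
Proof.
move=> aO bO abJ; have /eqP rab : rank (a * b)%g == n - 1 by move: abJ; rewrite inE.
have h c : c \in On n -> n - 1 <= rank c -> c = 1%g \/ c \in Jn1 n.
  move=> cO rc; have [e|ne] := eqVneq (rank c) n; first by left; apply: rank_eq1.
  by right; rewrite inE; have := rank_le c; lia.
by split; apply: h => //; rewrite -rab ?rank_mull ?rank_mulr.
Qed.

(** In a product [fold_skip i j * fold_skip k l] of rank [n - 1], the vertices
    [2j] and [2k + 1] are adjacent, so they are not both in [A]. *)
Lemma indep_subsemigroup_closed A : independent (@path_graph m) A ->
  subsemigroup (On n) (IS A).
Proof.
move/independentP => iA; apply/subsemigroupP; split.
  by apply/subsetP => a /indep_subsemigroupP[].
move=> x y xS yS; have /indep_subsemigroupP[xO hx] := xS;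
  have /indep_subsemigroupP[yO hy] := yS.
apply/indep_subsemigroupP; split; first exact: OnM.
move=> xyJ; have [[x1|xJ] [y1|yJ]] := Jn1_factors xO yO xyJ.
- by move: xyJ; rewrite x1 y1 mulg1 inE rank1; lia.
- by rewrite x1 mul1g; exact: hy.
- by rewrite y1 mulg1; exact: hx.
have [i [j [hi hj ex xA]]] := hx xJ; have [k [l [hk hl ey yA]]] := hy yJ.
have /(Jn1_OnP hn)[i' [j' [hi' hj' exy]]] : (x * y)%g \in Jn1 n :&: On n.
  by rewrite in_setI xyJ OnM.
rewrite ex ey in exy *.
have jk := fold_skip_mul_J hi hj hk hl hi' hj' exy.
exists i, l; split=> //; first exact: fold_skip_mul.
case/orP: xA => [jA|->]; last by rewrite orbT.
case/orP: yA => [->//|kA].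
case/orP: jk => /eqP ej; subst j; first by have := iA k.*2; rewrite jA kA.
by have := iA k.*2.+1; rewrite kA /= -doubleS jA.
Qed.

Lemma indep_subsemigroup_proper A : proper_indep A -> IS A \proper On n.
Proof.
case/proper_indepP => iA [i hi iN] [j hj jN]; rewrite properE.
have /subsemigroupP[-> _] /= : subsemigroup (On n) (IS A).
  by apply: indep_subsemigroup_closed; apply/independentP.
apply/subsetPn; exists (fold_skip n i j); first exact: fold_skip_On.
by rewrite fold_skip_indep // negb_or jN.
Qed.

Lemma indep_subsemigroupS A B : A \subset B -> IS A \subset IS B.
Proof.
move/memn_sub => AB; apply/subsetP => a /indep_subsemigroupP[aO ha];
  apply/indep_subsemigroupP; split=> //.
move=> /ha[i [j [hi hj ea h]]]; exists i, j; split=> //.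
by case/orP: h => /AB ->; rewrite ?orbT.
Qed.

(** Inclusion of subsemigroups reflects inclusion of independent sets: pair the
    class at a vertex of [A] with a class of the other kind outside [B]. *)
Lemma indep_subsemigroup_subset A B : proper_indep B -> IS A \subset IS B -> A \subset B.
Proof.
case/proper_indepP => iB [i hi iN] [j hj jN] /subsetP AB; apply/memn_sub => k kA.
have km := memn_lt kA.
have [ok|ek] := boolP (odd k).
  have hk : k./2.+1 < n by lia.
  have ek : k./2.*2.+1 = k by lia.
  by have := AB (fold_skip n k./2 j); rewrite !fold_skip_indep // ek kA orbT (negbTE
    jN) => /(_ isT).
have hk : k./2 < n by lia.
have ek' : k./2.*2 = k by lia.
by have := AB (fold_skip n i k./2); rewrite !fold_skip_indep // ek' kA (negbTE iN)
  orbF => /(_ isT).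
Qed.

Lemma indep_subsemigroup_inj A B : proper_indep A -> proper_indep B -> IS A = IS B ->
  A = B.
Proof.
by move=> gA gB e; apply/eqP; rewrite eqEsubset !indep_subsemigroup_subset ?e.
Qed.

(** The independent set is read off from an element [fold_skip i0 l0] outside
    [M], as the [L]-classes and the complement of the [R]-classes that can be
    reached from the [R]-class of [i0] by multiplying inside [M]. *)
Lemma subsemigroup_sub_indep M : subsemigroup (On n) M -> M \proper On n ->
  On n :\: Jn1 n \subset M -> exists2 A, proper_indep A & M \subset IS A.
Proof.
move=> /subsemigroupP[MO MM] /properP[_ [a aO aM]] /subsetP JM.
have aJ : a \in Jn1 n by apply: contraNT aM => aJ; apply: JM; rewrite in_setD aJ.
have [i0 [l0 [hi0 hl0 ea]]] : exists i j, [/\ i.+1 < n, j < n & a = fold_skip n i j].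
  by apply/Jn1_OnP; rewrite // in_setI aJ.
rewrite {a aO aJ}ea in aM.
pose X l := fold_skip n i0 l \in M.
pose p k := if odd k then [&& k != i0.*2.+1, ~~ X k./2 & ~~ X k./2.+1] else X k./2.
exists [set v : 'I_m | p v].
  apply/proper_indepP; split.
  - move=> k; rewrite !memn_set /p /=; case ok: (odd k) => /=.
      have -> : uphalf k = k./2.+1 by lia.
      by lia.
    have -> : uphalf k = k./2 by lia.
    by lia.
  - by exists i0; rewrite // memn_set /p /= odd_double /= eqxx andbF.
  - by exists l0; rewrite // memn_set /p /= odd_double /= doubleK /X (negbTE aM) andbF.
apply/subsetP => x xM; apply/indep_subsemigroupP; split; first exact: (subsetP MO).
move=> xJ; have /(Jn1_OnP hn)[i [l [hi hl ex]]] : x \in Jn1 n :&: On n.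
  by rewrite in_setI xJ (subsetP MO).
exists i, l; split=> //; rewrite !memn_set /p /= !odd_double /= uphalf_double !doubleK.
have -> : l.*2 < m by lia.
have -> : i.*2.+1 < m by lia.
rewrite /=; have [e|ii0] := eqVneq i i0; first by rewrite /X -e -ex xM.
have -> : i.*2.+1 != i0.*2.+1 by lia.
have key j : j < n -> (j == i) || (j == i.+1) -> X j -> X l.
  by move=> hj ji Xj; rewrite /X -(fold_skip_mul hi0 hj hi hl ji) MM // -ex.
case Xi: (X i); first by rewrite (key i) ?eqxx //; lia.
by case Xi1: (X i.+1); rewrite ?orbT // (key i.+1) ?eqxx ?orbT.
Qed.

Lemma subsemigroup_setD1 : subsemigroup (On n) (On n :\ 1%g).
Proof.
apply/subsemigroupP; split; first exact: subD1set.
move=> x y /setD1P[x1 xO] /setD1P[y1 yO]; rewrite in_setD1 OnM // andbT.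
apply: contraNneq x1 => xy1; apply/eqP/rank_eq1 => //; apply/eqP.
by rewrite eqn_leq rank_le -{1}(rank1 n) -xy1 rank_mull.
Qed.

Lemma maximal_subsemigroupP M : reflect
  [/\ subsemigroup (On n) M, M \proper On n &
      forall N, subsemigroup (On n) N -> N \proper On n -> M \subset N -> N = M]
  (maximal_subsemigroup (On n) M).
Proof.
apply: (iffP maxsetP) => [[/andP[sM pM] h]|[sM pM h]]; split=> //.
- by move=> N sN pN; apply: h; rewrite sN.
- by rewrite sM.
- by move=> N /andP[sN pN]; apply: h.
Qed.

Lemma maximal_setD1 : maximal_subsemigroup (On n) (On n :\ 1%g).
Proof.
apply/maximal_subsemigroupP; split; first exact: subsemigroup_setD1.
  by apply: properD1; exact: On1.
move=> N /subsemigroupP[NO _] pN sub; apply/eqP; rewrite eqEsubset sub andbT.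
rewrite subsetD1 NO /=; apply: contraL pN => N1.
by rewrite properE negb_and negbK -(setD1K (On1 n)) subUset sub1set N1 sub orbT.
Qed.

(** Apart from the removal of 1, the maximal subsemigroups are those given by the
    maximal sets among the independent sets missing a vertex of each parity. *)
Lemma maximal_subsemigroupE M : maximal_subsemigroup (On n) M <->
  M = On n :\ 1%g \/ exists2 A, maxset proper_indep A & M = IS A.
Proof.
split=> [/maximal_subsemigroupP[sM pM max]|[->|[A /maxsetP[gA maxA] ->]]]; last first.
- have /proper_indepP[iA _ _] := gA.
  apply/maximal_subsemigroupP; split; [by apply: indep_subsemigroup_closed;
    apply/independentP | exact: indep_subsemigroup_proper |].
  move=> N sN pN sub.
  have [B gB NB] := subsemigroup_sub_indep sN pN (subset_trans
    (indep_subsemigroup_low A) sub).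
  have AB : A \subset B by apply: indep_subsemigroup_subset => //; exact: subset_trans NB.
  by apply/eqP; rewrite eqEsubset sub -{1}(maxA B) // NB.
- exact: maximal_setD1.
have /subsemigroupP[MO MM] := sM.
have [M1|M1] := boolP (1%g \in M); last first.
  left; apply/esym/max; first exact: subsemigroup_setD1.
    by apply: properD1; exact: On1.
  by rewrite subsetD1 MO.
right; have sub : On n :\: Jn1 n \subset M.
  (* Adding all elements outside the J-class to [M] gives a subsemigroup, which
     is proper because [O_n] is generated by 1 and the J-class. *)
  pose N := M :|: (On n :\: Jn1 n).
  have NO : N \subset On n by rewrite subUset MO subsetDl.
  suff <- : N = M by exact: subsetUr.
  have NJ x : x \in N -> x \in Jn1 n -> x \in M.
    by rewrite in_setU in_setD => /orP[//|/andP[/negbTE->]].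
  apply: max; last exact: subsetUl.
    apply/subsemigroupP; split=> // x y xN yN.
    have [xO yO] := (subsetP NO x xN, subsetP NO y yN).
    have [xyJ|xyJ] := boolP ((x * y)%g \in Jn1 n); last first.
      by rewrite in_setU in_setD xyJ OnM ?orbT.
    have [[->|xJ] [->|yJ]] := Jn1_factors xO yO xyJ; rewrite ?mul1g ?mulg1 //.
      by rewrite in_setU M1.
    by rewrite in_setU MM ?NJ.
  rewrite properE NO /=; apply: contraL pM => ON.
  rewrite properE negb_and negbK; apply/orP; right.
  apply: On_generated => // i j hi hj; apply: NJ; last by rewrite inE rank_fold_skip.
  by apply: (subsetP ON); exact: fold_skip_On.
have [A gA MA] := subsemigroup_sub_indep sM pM sub.
have [B maxB AB] := maxset_exists gA.
exists B => //; apply/esym/max; last exact: subset_trans MA (indep_subsemigroupS AB).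
  have /maxsetP[/proper_indepP[iB _ _] _] := maxB.
  by apply: indep_subsemigroup_closed; apply/independentP.
by apply: indep_subsemigroup_proper; case/maxsetP: maxB.
Qed.

End Maximal.

(** * Counting the maximal independent sets of a path *)

(** The bit sequence of a maximal independent set of a path: no two consecutive
    bits are set, and each unset bit has a set neighbour. *)
Definition maximal_indep_seq (s : seq bool) : Prop :=
  (forall i, ~~ (nth false s i && nth false s i.+1)) /\
  (forall i, i < size s ->
     [|| nth false s i, nth false s i.+1 | (0 < i) && nth false s i.-1]).

(** All such sequences of length [k], according to whether the first or the
    second bit is set. *)
Fixpoint maximal_indep_seqs (k : nat) : seq (seq bool) :=
  match k with
  | 0 => [:: [::]]
  | 1 => [:: [:: true]]
  | 2 => [:: [:: true; false]; [:: false; true]]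
  | ((k3.+1) as k2).+2 =>
      map (fun s => [:: true, false & s]) (maximal_indep_seqs k2) ++
      map (fun s => [:: false, true, false & s]) (maximal_indep_seqs k3)
  end.

Lemma maximal_indep_seq_TF s : maximal_indep_seq [:: true, false & s] <->
  maximal_indep_seq s.
Proof.
split=> -[ind dom]; split.
- by move=> i; exact: ind i.+2.
- move=> i hi; have := dom i.+2 hi; by case: i hi => [|i] hi //=; rewrite ?orbF.
- by case=> [|[|i]] //=; exact: ind.
- case=> [|[|i]] hi; rewrite /= ?orbT //; have := dom i hi.
  by case: i hi => [|i] hi //=; rewrite ?orbF.
Qed.

Lemma maximal_indep_seq_FTF s : maximal_indep_seq [:: false, true, false & s] <->
  maximal_indep_seq s.
Proof.
split=> -[ind dom]; split.
- by move=> i; exact: ind i.+3.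
- move=> i hi; have := dom i.+3 hi; by case: i hi => [|i] hi //=; rewrite ?orbF.
- by case=> [|[|[|i]]] //=; exact: ind.
- case=> [|[|[|i]]] hi; rewrite /= ?orbT //; have := dom i hi.
  by case: i hi => [|i] hi //=; rewrite ?orbF.
Qed.

Lemma nat_ind3 (P : nat -> Prop) : P 0 -> P 1 -> P 2 ->
  (forall k, P k -> P k.+1 -> P k.+3) -> forall k, P k.
Proof.
move=> p0 p1 p2 ps k; suff [] : [/\ P k, P k.+1 & P k.+2] by [].
by elim: k => // k [pk pk1 pk2]; split=> //; exact: ps.
Qed.

Lemma mem_maximal_indep_seqs k s : s \in maximal_indep_seqs k <-> size s = k /\
  maximal_indep_seq s.
Proof.
elim/nat_ind3: k s => [||| k IH0 IH1] s.
- rewrite inE; split=> [/eqP->|[/size0nil->]] //.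
  by split=> //; split=> // i; rewrite !nth_nil.
- rewrite inE; split=> [/eqP->|[]].
    by do !split=> //; case=> [|i] //=; rewrite ?nth_nil.
  by case: s => [|[] [|? ?]] // _ [_ /(_ 0 isT)].
- rewrite !inE; split=> [/orP[]/eqP->|[]].
  + by do !split=> //; case=> [|[|i]] //=; rewrite ?nth_nil.
  + by do !split=> //; case=> [|[|i]] //=; rewrite ?nth_nil.
  + by case: s => [|[] [|[] [|? ?]]] // _ [/(_ 0) //= _ /(_ 0 isT)].
rewrite mem_cat; split=> [/orP[]/mapP[t]|].
- by move=> /IH1[<- mt] ->; rewrite /= maximal_indep_seq_TF.
- by move=> /IH0[<- mt] ->; rewrite /= maximal_indep_seq_FTF.
case: s => [|[] [|[] s]] [] //; first by move=> _ [/(_ 0)].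
- move=> [es]; rewrite maximal_indep_seq_TF => ms; apply/orP; left.
  by apply/mapP; exists s => //; apply/IH1.
- case: s => [|[] s] //; first by move=> _ [/(_ 1)].
  move=> [es]; rewrite maximal_indep_seq_FTF => ms; apply/orP; right.
  by apply/mapP; exists s => //; apply/IH0.
- by move=> _ [_ /(_ 0 isT)].
Qed.

Lemma uniq_maximal_indep_seqs k : uniq (maximal_indep_seqs k).
Proof.
elim/nat_ind3: k => // k u0 u1.
rewrite -[maximal_indep_seqs k.+3]/(_ ++ _) cat_uniq.
rewrite map_inj_uniq ?u1 => [|? ? [] //].
rewrite map_inj_uniq ?u0 => [|? ? [] //].
by rewrite andbT; apply/hasPn => _ /mapP[s _ ->]; apply/negP => /mapP[].
Qed.

Lemma size_maximal_indep_seqs k : size (maximal_indep_seqs k.+1) = Aseq k.+1.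
Proof.
elim/nat_ind3: k => // k IH0 IH1.
rewrite -[maximal_indep_seqs k.+4]/(_ ++ _) size_cat !size_map addnC.
by rewrite -[Aseq k.+4]/(Aseq k.+2 + Aseq k.+1) -IH0 -IH1 addnC.
Qed.

Section Card.
Variable m : nat.
Implicit Types (A B : {set 'I_m}).

(** The indicator sequence of a set of ordinals. *)
Definition bits A : seq bool := mkseq (memn A) m.

Lemma nth_bits A i : nth false (bits A) i = memn A i.
Proof.
have [im|mi] := ltnP i m; first by rewrite nth_mkseq.
rewrite nth_default ?size_mkseq //; apply/esym/negbTE/negP => /memn_lt; lia.
Qed.

Lemma bits_inj : injective bits.
Proof.
by move=> A B e; apply: memn_ext => k _; rewrite -!nth_bits e.
Qed.

Lemma bits_surj s : size s = m -> exists A, s = bits A.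
Proof.
move=> es; exists [set v : 'I_m | nth false s v].
apply: (@eq_from_nth _ false); first by rewrite size_mkseq.
by move=> i hi; rewrite nth_bits memn_set -es hi.
Qed.

Lemma maximal_independentP A : maximal_independent (@path_graph m) A <->
  maximal_indep_seq (bits A).
Proof.
split=> [/maxsetP[/independentP iA maxA]|[iA dA]].
  split=> [i|i]; first by rewrite !nth_bits.
  rewrite size_mkseq !nth_bits => im.
  apply/negPn/negP; rewrite !negb_or => /and3P[iN i1N ipN].
  suff e : Ordinal im |: A = A.
    by move: iN; rewrite -e -[X in memn _ X]/(val (Ordinal im)) memn_val setU11.
  apply: maxA; last exact: subsetUr.
  have memU k : memn (Ordinal im |: A) k = (k == i) || memn A k.
    have [km|mk] := ltnP k m.
      by rewrite -[k]/(val (Ordinal km)) !memn_val in_setU1 -val_eqE.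
    apply/idP/idP => [/memn_lt|/orP[/eqP|/memn_lt]]; lia.
  apply/independentP => k; rewrite !memU.
  case: (eqVneq k i) => [->|ki] /=; first by rewrite (negbTE i1N) orbF; lia.
  case: (eqVneq k.+1 i) => [e|k1i] /=; last exact: iA.
  by move: ipN; rewrite -e /= andbT.
apply/maxsetP; split=> [|B /independentP iB AB].
  by apply/independentP => k; have := iA k; rewrite !nth_bits.
apply/eqP; rewrite eqEsubset AB andbT; apply/memn_sub => k kB.
have := dA k; rewrite size_mkseq (memn_lt kB) !nth_bits => /(_ isT).
move/memn_sub: AB => AB; case/or3P => // [/AB k1B|/andP[k0 /AB kpB]].
  by have := iB k; rewrite kB k1B.
by have := iB k.-1; rewrite kpB prednK // kB.
Qed.

Lemma card_maximal_independent :
  0 < m -> #|[set A | maximal_independent (@path_graph m) A]| = Aseq m.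
Proof.
move=> m0; rewrite -(prednK m0) -size_maximal_indep_seqs (prednK m0) cardE -(size_map
  bits).
apply/perm_size/uniq_perm; rewrite ?map_inj_uniq ?enum_uniq ?uniq_maximal_indep_seqs //.
  exact: bits_inj.
move=> s; apply/mapP/idP => [[A]|].
  by rewrite mem_enum inE => /maximal_independentP h ->; apply/mem_maximal_indep_seqs;
    rewrite size_mkseq.
case/mem_maximal_indep_seqs => /bits_surj[A ->] h; exists A => //.
by rewrite mem_enum inE; apply/maximal_independentP.
Qed.

End Card.

(** * Classification, types and number of the maximal subsemigroups *)

Section Classification.
Variable n : nat.
Hypothesis hn : 2 <= n.
Notation m := (2 * n - 1).
Notation path := (@path_graph m).
Notation proper_indep := (@proper_indep n).
Notation IS := (@independent_subsemigroup n).
Implicit Types (i j k l : nat) (A B : {set 'I_m}) (M : {set PT n}).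

(** The sets of [L]-vertices and of [R]-vertices, and the same sets without the
    vertex of the class with index [j], resp. [i]. *)
Definition Lset : {set 'I_m} := [set v : 'I_m | ~~ odd v].
Definition Rset : {set 'I_m} := [set v : 'I_m | odd v].
Definition dropL j : {set 'I_m} := [set v : 'I_m | ~~ odd v && (v != j.*2 :> nat)].
Definition dropR i : {set 'I_m} := [set v : 'I_m | odd v && (v != i.*2.+1 :> nat)].

Lemma memn_Lset k : memn Lset k = (k < m) && ~~ odd k.
Proof. exact: (memn_set _ (fun k => ~~ odd k)). Qed.
Lemma memn_Rset k : memn Rset k = (k < m) && odd k.
Proof. exact: (memn_set _ (fun k => odd k)). Qed.
Lemma memn_dropL j k : memn (dropL j) k = (k < m) && (~~ odd k && (k != j.*2)).
Proof. exact: (memn_set _ (fun k => ~~ odd k && (k != j.*2))). Qed.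
Lemma memn_dropR i k : memn (dropR i) k = (k < m) && (odd k && (k != i.*2.+1)).
Proof. exact: (memn_set _ (fun k => odd k && (k != i.*2.+1))). Qed.

Definition memnE := (memn_Lset, memn_Rset, memn_dropL, memn_dropR).

Lemma Lset_maximal : maximal_independent path Lset.
Proof.
apply/maximal_independentP; split=> [k|k].
  by rewrite !nth_bits !memnE /=; lia.
by rewrite size_mkseq !nth_bits !memnE => km; case: k km => [|k] //= km; lia.
Qed.

Lemma Rset_maximal : maximal_independent path Rset.
Proof.
apply/maximal_independentP; split=> [k|k].
  by rewrite !nth_bits !memnE /=; lia.
by rewrite size_mkseq !nth_bits !memnE => km; case: k km => [|k] //= km; lia.
Qed.

Lemma Lset_neq_Rset : Lset != Rset.
Proof.
apply/eqP => e; have : memn Lset 0 = memn Rset 0 by rewrite e.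
by rewrite !memnE /=; lia.
Qed.

Lemma maximal_independent_eq A B :
  maximal_independent path A -> independent path B -> A \subset B -> B = A.
Proof. by move=> /maxsetP[_ h] iB AB; apply: h. Qed.

Lemma independent_maximal A : maximal_independent path A -> independent path A.
Proof. by case/maxsetP. Qed.

Lemma proper_indepE A :
  proper_indep A = [&& independent path A, ~~ (Lset \subset A) & ~~ (Rset \subset A)].
Proof.
apply/and3P/and3P => -[iA h1 h2]; split=> //.
- case/existsP: h2 => v /andP[ov vA]; apply/subsetPn; exists v; rewrite ?inE //.
- case/existsP: h1 => v /andP[ov vA]; apply/subsetPn; exists v; rewrite ?inE //.
- by case/subsetPn: h2 => v; rewrite inE => ov vA; apply/existsP; exists v; rewrite ov.
- by case/subsetPn: h1 => v; rewrite inE => ov vA; apply/existsP; exists v; rewrite ov.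
Qed.

Lemma has_both_paritiesE A : maximal_independent path A ->
  has_both_parities A = (A != Lset) && (A != Rset).
Proof.
move=> mA; have iA := independent_maximal mA.
rewrite /has_both_parities andbC; congr andb.
- apply/existsP/idP => [[v /andP[vA ov]]|neL]; first apply/eqP => e.
    by move: vA ov; rewrite e inE /label /= => ->.
  apply/existsP; apply: contraT => /existsPn h; case/eqP: neL; apply/esym.
  apply: (maximal_independent_eq mA (independent_maximal Lset_maximal)).
  by apply/subsetP => v vA; have := h v; rewrite vA inE /label /= negbK.
- apply/existsP/idP => [[v /andP[vA ov]]|neR]; first apply/eqP => e.
    by move: vA ov; rewrite e inE /label /= => ->.
  apply/existsP; apply: contraT => /existsPn h; case/eqP: neR; apply/esym.
  apply: (maximal_independent_eq mA (independent_maximal Rset_maximal)).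
  by apply/subsetP => v vA; have := h v; rewrite vA inE /label /= negbK.
Qed.

Lemma maximal_both_proper A : maximal_independent path A -> has_both_parities A ->
  maxset proper_indep A.
Proof.
move=> mA; rewrite has_both_paritiesE // => /andP[neL neR].
apply/maxsetP; split=> [|B gB AB]; last first.
  by apply: maximal_independent_eq => //; case/and3P: gB.
rewrite proper_indepE (independent_maximal mA) /=; apply/andP; split.
  by apply: contra neL => sub; rewrite (maximal_independent_eq Lset_maximal _ sub) //
    (independent_maximal mA).
by apply: contra neR => sub; rewrite (maximal_independent_eq Rset_maximal _ sub) //
  (independent_maximal mA).
Qed.

Lemma dropL_proper j : j < n -> proper_indep (dropL j).
Proof.
move=> hj; apply/proper_indepP => //; split=> [k||].
- by rewrite !memnE /=; lia.
- by exists 0; rewrite // memnE andbF.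
- by exists j; rewrite // memnE eqxx !andbF.
Qed.

Lemma dropR_proper i : i.+1 < n -> proper_indep (dropR i).
Proof.
move=> hi; apply/proper_indepP => //; split=> [k||].
- by rewrite !memnE /=; lia.
- by exists i; rewrite // memnE eqxx !andbF.
- by exists 0; rewrite ?memnE /=; lia.
Qed.

Lemma dropL_maximal j : j < n -> maxset proper_indep (dropL j).
Proof.
move=> hj; apply/maxsetP; split=> [|B /(proper_indepP hn)[iB _ [l hl lB]] /memn_sub sub].
  exact: dropL_proper.
have lj : l = j.
  apply/eqP; apply: contraNT lB => lj; apply: sub; rewrite memnE; lia.
subst l; apply: memn_ext => k km; rewrite memnE km /=.
have [kB|kB] := boolP (memn B k); last first.
  apply/esym/negbTE; apply: contra kB => h; apply: sub; rewrite memnE; lia.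
apply/esym; have kj : k != j.*2 by apply: contraNneq lB => <-.
rewrite kj andbT; apply/negP => ok.
have := iB k; have := iB k.-1; have ek : k.-1.+1 = k by lia.
rewrite ek kB andbT /= => hp hs.
have : k.-1 = j.*2.
  by apply/eqP; apply: contraNT hp => ne; apply: sub; rewrite memnE; lia.
have : k.+1 = j.*2.
  by apply/eqP; apply: contraNT hs => ne; apply: sub; rewrite memnE; lia.
lia.
Qed.

Lemma dropR_maximal i : 0 < i -> i.+2 < n -> maxset proper_indep (dropR i).
Proof.
move=> i0 hi; apply/maxsetP; split=> [|B /(proper_indepP hn)[iB [l hl lB] _]
  /memn_sub sub].
  by apply: dropR_proper; lia.
have li : l = i.
  apply/eqP; apply: contraNT lB => lj; apply: sub; rewrite memnE; lia.
subst l; apply: memn_ext => k km; rewrite memnE km /=.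
have [kB|kB] := boolP (memn B k); last first.
  apply/esym/negbTE; apply: contra kB => h; apply: sub; rewrite memnE; lia.
apply/esym; have ki : k != i.*2.+1 by apply: contraNneq lB => <-.
rewrite ki andbT; apply/negPn/negP => ok.
have hp : 0 < k -> k.-1 = i.*2.+1.
  move=> k0; apply/eqP; have := iB k.-1; have ek : k.-1.+1 = k by lia.
  by rewrite ek kB andbT; apply: contraNT => ne; apply: sub; rewrite memnE; lia.
have hs : k.+1 < m -> k.+1 = i.*2.+1.
  move=> k0; apply/eqP; have := iB k; rewrite kB /=.
  by apply: contraNT => ne; apply: sub; rewrite memnE; lia.
lia.
Qed.

(** If [R]-vertex [i] is the only neighbour of [L]-vertex [j], the latter can be
    added to the set of all other [R]-vertices. *)
Lemma dropR_end_not_maximal i j : i.+1 < n -> j < n ->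
  (forall l, (l == j.*2.+1) || (l.+1 == j.*2) -> l < m -> l = i.*2.+1) ->
  ~~ maxset proper_indep (dropR i).
Proof.
move=> hi hj nb; apply/negP => /maxsetP[_ mx].
pose p k := (odd k && (k != i.*2.+1)) || (k == j.*2).
pose B := [set v : 'I_m | p v].
have memB k : memn B k = (k < m) && p k by exact: memn_set.
have e : B = dropR i.
  apply: mx; last first.
    by apply/memn_sub => k; rewrite memnE memB /p => /andP[-> ->].
  apply/proper_indepP => //; split=> [k||].
  - by rewrite !memB /p; have := nb k; have := nb k.+1; lia.
  - by exists i; rewrite // memB /p; lia.
  - by exists (if j == 0 then 1 else 0); rewrite ?memB /p; case: (eqVneq j 0); lia.
have : memn B j.*2 by rewrite memB /p eqxx orbT andbT; lia.
by rewrite e memnE; lia.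
Qed.

(** In the non-maximal case, every larger independent set contains all vertices
    of one kind, so it is the set of these vertices. *)
Lemma maxset_proper_indepP A : maxset proper_indep A <->
  [\/ maximal_independent path A /\ has_both_parities A,
      exists2 j, j < n & A = dropL j
    | exists i, [/\ 0 < i, i.+2 < n & A = dropR i]].
Proof.
split=> [mA|[[] | [j hj ->] | [i [i0 hi ->]]]]; last 3 first.
- exact: maximal_both_proper.
- exact: dropL_maximal.
- exact: dropR_maximal.
have /maxsetP[gA maxA] := mA.
move: (gA); rewrite proper_indepE => /and3P[iA nL nR].
have [B mB AB] := maxset_exists iA.
have iB := independent_maximal mB.
have [gB|] := boolP (proper_indep B).
  have e : B = A by apply: maxA.
  rewrite e in mB; constructor 1; split=> //; rewrite has_both_paritiesE //.
  by apply/andP; split; [apply: contraNneq nL | apply: contraNneq nR] => ->.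
rewrite proper_indepE iB /= negb_and !negbK => /orP[] sub.
- have eB := maximal_independent_eq Lset_maximal iB sub; rewrite {}eB in AB.
  case/subsetPn: nL => v vL vA; rewrite inE in vL.
  have hv : v./2 < n by have := ltn_ord v; lia.
  constructor 2; exists v./2 => //; apply/esym/maxA; first exact: dropL_proper.
  apply/memn_sub => k kA; move/memn_sub/(_ k kA): AB; rewrite !memnE => /andP[-> ->] /=.
  apply: contraNneq vA => e; rewrite -memn_val; have <- : k = v by lia.
  by [].
- have eB := maximal_independent_eq Rset_maximal iB sub; rewrite {}eB in AB.
  case/subsetPn: nR => v vL vA; rewrite inE in vL.
  have hv : v./2.+1 < n by have := ltn_ord v; lia.
  have eA : dropR v./2 = A.
    apply/maxA; first exact: dropR_proper.
    apply/memn_sub => k kA; move/memn_sub/(_ k kA): AB; rewrite !memnE => /andP[-> ->] /=.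
    apply: contraNneq vA => e; rewrite -memn_val; have <- : k = v by lia.
    by [].
  rewrite -eA in mA *; constructor 3; exists v./2; split=> //.
  + rewrite lt0n; apply: contraL mA => /eqP v0.
    by apply: (@dropR_end_not_maximal _ 0) => //; lia.
  + rewrite ltn_neqAle hv andbT; apply: contraL mA => /eqP v0.
    by apply: (@dropR_end_not_maximal _ n.-1) => //; lia.
Qed.

(** Removing a set [K] of elements of rank [n - 1] from [O_n] yields the
    subsemigroup of [A], if [K] consists of the [fold_skip i j] not covered by
    [A]. *)
Lemma On_setD_IS (K : {set PT n}) A :
  (forall i j, i.+1 < n -> j < n ->
     (fold_skip n i j \in K) = ~~ (memn A j.*2 || memn A i.*2.+1)) ->
  K :&: On n \subset Jn1 n -> On n :\: K = IS A.
Proof.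
move=> h /subsetP KJ; apply/setP => a; rewrite in_setD.
apply/andP/indep_subsemigroupP => // [[aK aO]|[aO ha]]; split=> //.
  move=> aJ; have /(Jn1_OnP hn)[i [j [hi hj ea]]] : a \in Jn1 n :&: On n.
    by rewrite in_setI aJ.
  by exists i, j; split=> //; move: aK; rewrite ea h // negbK.
apply/negP => aK; have aJ : a \in Jn1 n by apply: KJ; rewrite in_setI aK.
by have [i [j [hi hj ea hA]]] := ha aJ; move: aK; rewrite ea h // hA.
Qed.

Lemma On_setD_L j : j < n -> On n :\: (L n j.+1 :&: On n) = IS (dropL j).
Proof.
move=> hj; apply: On_setD_IS => [i' j' hi' hj'|]; last first.
  by rewrite -setIA setIid; apply/subsetP => a; rewrite !inE => /andP[/andP[]].
apply/(L_OnP hn _ hj)/idP => [[i hi /fold_skip_inj[]// _ ->]|].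
  by rewrite !memnE; lia.
by rewrite !memnE => h; exists i' => //; congr fold_skip; lia.
Qed.

Lemma On_setD_R i : i.+1 < n -> On n :\: R n i.+1 i.+2 = IS (dropR i).
Proof.
move=> hi; apply: On_setD_IS => [i' j' hi' hj'|]; last first.
  by apply/subsetP => a; rewrite !inE => /andP[/andP[]].
have -> : (fold_skip n i' j' \in R n i.+1 i.+2) = (fold_skip n i' j' \in R n i.+1
  i.+2 :&: On n).
  by rewrite in_setI fold_skip_On ?andbT.
apply/(R_OnP hn _ hi)/idP => [[j hj /fold_skip_inj[]// -> _]|].
  by rewrite !memnE; lia.
by rewrite !memnE => h; exists j' => //; congr fold_skip; lia.
Qed.

Lemma Lclasses_J (K : {set PT n}) :
  (K \in Lclasses (On n) (Jn1 n :&: On n)) <->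
  exists2 j, j < n & K = L n j.+1 :&: On n.
Proof.
split=> [/imsetP[a /(Jn1_OnP hn)[i [j [hi hj ->]]] ->]|[j hj ->]].
  by exists j; rewrite // Lclass_fold_skip.
apply/imsetP; exists (fold_skip n 0 j); last by rewrite Lclass_fold_skip.
by apply/Jn1_OnP => //; exists 0, j.
Qed.

Lemma Rclasses_J (K : {set PT n}) :
  (K \in Rclasses (On n) (Jn1 n :&: On n)) <->
  exists2 i, i.+1 < n & K = R n i.+1 i.+2 :&: On n.
Proof.
split=> [/imsetP[a /(Jn1_OnP hn)[i [j [hi hj ->]]] ->]|[i hi ->]].
  by exists i; rewrite // Rclass_fold_skip.
have n0 : 0 < n by lia.
apply/imsetP; exists (fold_skip n i 0); last by rewrite Rclass_fold_skip.
by apply/Jn1_OnP => //; exists i, 0.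
Qed.

Lemma family_cP M : family_c M <-> exists2 j, j < n & M = IS (dropL j).
Proof.
split=> [[K /Lclasses_J[j hj ->] ->]|[j hj ->]].
  by exists j; rewrite ?On_setD_L.
exists (L n j.+1 :&: On n); last by rewrite On_setD_L.
by apply/Lclasses_J; exists j.
Qed.

Lemma family_dP M :
  family_d M <-> exists i, [/\ 0 < i, i.+2 < n & M = IS (dropR i)].
Proof.
split=> [[[//|i] hi ->]|[i [i0 hi ->]]].
  exists i; split; try lia.
  by rewrite addn1 On_setD_R //; lia.
exists i.+1; first lia.
by rewrite addn1 On_setD_R //; lia.
Qed.

Lemma maximal_families M : maximal_subsemigroup (On n) M <->
  [\/ family_a M, family_b M, family_c M | family_d M].
Proof.
split=> [/(maximal_subsemigroupE hn)[->|[A /maxset_proper_indepP h ->]]|h].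
- by constructor 1.
- case: h => [[mA bA]|[j hj ->]|[i [i0 hi ->]]].
  + by constructor 2; exists A.
  + by constructor 3; apply/family_cP; exists j.
  + by constructor 4; apply/family_dP; exists i.
apply/(maximal_subsemigroupE hn); case: h => [->|[A [mA bA ->]]|/family_cP[j hj
  ->]|/family_dP[i [i0 hi ->]]].
- by left.
- by right; exists A => //; exact: maximal_both_proper.
- by right; exists (dropL j) => //; exact: dropL_maximal.
- by right; exists (dropR i) => //; exact: dropR_maximal.
Qed.

Lemma arises_from_Jn1 M : On n :\: Jn1 n \subset M -> arises_from (On n) M (Jn1 n :&:
  On n).
Proof.
move=> /subsetP JM; apply/andP; split; first exact: Jn1_On_Jclass.
apply/subsetP => a; rewrite in_setD in_setI => /andP[aM aO]; rewrite aO andbT.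
by apply: contraNT aM => aJ; apply: JM; rewrite in_setD aJ.
Qed.

Lemma family_a_type M : family_a M -> type_M1 (On n) M.
Proof.
move=> ->; exists [set 1%g]; split; last first.
- by apply/setP => x; rewrite in_setI in_setD1 in_set1 in_set0; case: eqP; rewrite ?andbF.
- apply/forall_inP => x; rewrite inE => /eqP ->.
  by apply/exists_inP; exists 1%g; rewrite ?On1 ?mul1g.
apply/andP; split; last by rewrite setDDr setDv set0U subsetIr.
by apply/imsetP; exists 1%g; rewrite ?On1 // Jclass_id.
Qed.

Lemma family_c_type M : family_c M -> type_M3 (On n) M.
Proof.
move=> /family_cP[j hj eM]; exists (Jn1 n :&: On n); split.
- by apply: arises_from_Jn1; rewrite eM; exact: indep_subsemigroup_low.
- exact: Jn1_On_regular.
- apply/set0Pn; pose l := if j == 0 then 1 else 0.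
  have hl : l < n by rewrite /l; case: (j == 0); lia.
  exists (fold_skip n 0 l); rewrite in_setI eM fold_skip_indep // !memnE; apply/andP;
    split.
    by rewrite /l; case: (eqVneq j 0); lia.
  by apply/Jn1_OnP => //; exists 0, l.
exists (Lclasses (On n) (Jn1 n :&: On n) :\ (L n j.+1 :&: On n)).
  exact: subsetDl.
apply/setP => a; rewrite in_setI; apply/andP/bigcupP.
  case=> aM /(Jn1_OnP hn)[i [l [hi hl ea]]].
  move: aM; rewrite eM ea fold_skip_indep // !memnE => h.
  have lj : l != j by lia.
  exists (L n l.+1 :&: On n); last by apply/L_OnP => //; exists i.
  rewrite in_setD1; apply/andP; split; last by apply/Lclasses_J; exists l.
  apply: contraNneq lj => e.
  have : fold_skip n i l \in L n j.+1 :&: On n by rewrite -e; apply/L_OnP => //; exists i.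
  by case/(L_OnP hn _ hj) => i' hi' /fold_skip_inj[]// _ ->.
case=> K /setD1P[Kj /Lclasses_J[l hl eK]]; rewrite eK => /(L_OnP hn _ hl)[i hi ->].
split; last by apply/Jn1_OnP => //; exists i, l.
rewrite eM fold_skip_indep // !memnE.
have lj : l != j by apply: contraNneq Kj => <-; rewrite eK.
lia.
Qed.

Lemma family_d_type M : family_d M -> type_M4 (On n) M.
Proof.
move=> /family_dP[i [i0 hi eM]]; exists (Jn1 n :&: On n); split.
- by apply: arises_from_Jn1; rewrite eM; exact: indep_subsemigroup_low.
- exact: Jn1_On_regular.
- apply/set0Pn; have n0 : 0 < n by lia.
  exists (fold_skip n 0 0); rewrite in_setI eM fold_skip_indep // !memnE; apply/andP;
    split.
    by lia.
  by apply/Jn1_OnP => //; exists 0, 0.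
have hi' : i.+1 < n by lia.
exists (Rclasses (On n) (Jn1 n :&: On n) :\ (R n i.+1 i.+2 :&: On n)).
  exact: subsetDl.
apply/setP => a; rewrite in_setI; apply/andP/bigcupP.
  case=> aM /(Jn1_OnP hn)[k [l [hk hl ea]]].
  move: aM; rewrite eM ea fold_skip_indep // !memnE => h.
  have ki : k != i by lia.
  exists (R n k.+1 k.+2 :&: On n); last by apply/R_OnP => //; exists l.
  rewrite in_setD1; apply/andP; split; last by apply/Rclasses_J; exists k.
  apply: contraNneq ki => e.
  have : fold_skip n k l \in R n i.+1 i.+2 :&: On n by rewrite -e; apply/R_OnP => //;
    exists l.
  by case/(R_OnP hn _ hi') => l' hl' /fold_skip_inj[]// ->.
case=> K /setD1P[Kj /Rclasses_J[k hk eK]]; rewrite eK => /(R_OnP hn _ hk)[l hl ->].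
split; last by apply/Jn1_OnP => //; exists k, l.
rewrite eM fold_skip_indep // !memnE.
have ki : k != i by apply: contraNneq Kj => <-; rewrite eK.
lia.
Qed.

Lemma family_b_type M : family_b M -> type_M2 (On n) M.
Proof.
move=> [A [mA bA eM]]; have /maxsetP[gA _] := maximal_both_proper mA bA.
have /(proper_indepP hn)[_ [i0 hi0 iN] [j0 hj0 jN]] := gA.
exists (Jn1 n :&: On n); split; first by apply: arises_from_Jn1; rewrite eM;
  exact: indep_subsemigroup_low.
  exact: Jn1_On_regular.
pose LC (j : 'I_n) := L n j.+1 :&: On n.
pose RC (i : 'I_n) := R n i.+1 i.+2 :&: On n.
have LCsub : [set LC j | j : 'I_n & memn A j.*2] \subset Lclasses (On n) (Jn1 n :&: On n).
  by apply/subsetP => _ /imsetP[j _ ->]; apply/Lclasses_J; exists j.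
have RCsub : [set RC i | i : 'I_n & memn A i.*2.+1] \subset Rclasses (On n) (Jn1 n
  :&: On n).
  apply/subsetP => _ /imsetP[i iA ->]; apply/Rclasses_J; exists i => //.
  by move: iA; rewrite inE => /memn_lt; lia.
have /andP[/existsP[v /andP[vA ov]] /existsP[w /andP[wA ow]]] := bA.
rewrite /label /= in ov ow.
exists [set LC j | j : 'I_n & memn A j.*2], [set RC i | i : 'I_n & memn A i.*2.+1].
split.
- have hv : v./2 < n by have := ltn_ord v; lia.
  apply/set0Pn; exists (LC (Ordinal hv)); apply: imset_f; rewrite inE /=.
  by have -> : v./2.*2 = v; [lia | rewrite memn_val].
- rewrite properE LCsub /=; apply/subsetPn; exists (LC (Ordinal hj0)).
    by apply/Lclasses_J; exists j0.
  apply: contra jN => /imsetP[j jA e].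
  have : fold_skip n 0 j0 \in LC j by rewrite -e; apply/L_OnP => //; exists 0.
  case/(L_OnP hn _ (ltn_ord j)) => i hi /fold_skip_inj[]// _ ->.
  by move: jA; rewrite inE.
- have hw : w./2 < n by have := ltn_ord w; lia.
  apply/set0Pn; exists (RC (Ordinal hw)); apply: imset_f; rewrite inE /=.
  by have -> : w./2.*2.+1 = w; [lia | rewrite memn_val].
- rewrite properE RCsub /=; apply/subsetPn; exists (RC (Ordinal (ltnW hi0))).
    by apply/Rclasses_J; exists i0.
  apply: contra iN => /imsetP[i iA e].
  have n0 : 0 < n by lia.
  have : fold_skip n i0 0 \in RC i by rewrite -e; apply/R_OnP => //; exists 0.
  move: iA; rewrite inE => iA; have hi : i.+1 < n by have := memn_lt iA; lia.
  by case/(R_OnP hn _ hi) => l hl /fold_skip_inj[]// -> _.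
apply/setP => a; rewrite in_setI in_setU; apply/andP/orP.
  case=> aM /(Jn1_OnP hn)[k [l [hk hl ea]]].
  move: aM; rewrite eM ea fold_skip_indep // => /orP[h|h]; [left|right]; apply/bigcupP.
    exists (LC (Ordinal hl)); first by apply: imset_f; rewrite inE.
    by apply/L_OnP => //; exists k.
  exists (RC (Ordinal (ltnW hk))); first by apply: imset_f; rewrite inE.
  by apply/R_OnP => //; exists l.
case=> /bigcupP[_ /imsetP[k kA ->]]; move: kA; rewrite inE => kA.
  case/(L_OnP hn _ (ltn_ord k)) => i hi ->; split; last by apply/Jn1_OnP => //;
    exists i, k.
  by rewrite eM fold_skip_indep // kA.
have hk : k.+1 < n by have := memn_lt kA; lia.
case/(R_OnP hn _ hk) => l hl ->; split; last by apply/Jn1_OnP => //; exists k, l.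
by rewrite eM fold_skip_indep // kA orbT.
Qed.

(** The truncated [n - 3] is right also for [n = 2], where no [R]-vertex can be
    dropped. *)
Lemma card_maxset_proper_indep :
  #|[set A | maxset proper_indep A]| = Aseq m - 2 + n + (n - 3).
Proof.
pose S1 := [set A | maximal_independent path A] :\: [set Lset; Rset].
pose S2 := [set dropL j | j : 'I_n].
pose S3 := [set dropR i.+1 | i : 'I_(n - 3)].
have S1E A : (A \in S1) = maximal_independent path A && has_both_parities A.
  rewrite in_setD in_set2 inE negb_or andbC; case mA: maximal_independent => //=.
  by rewrite has_both_paritiesE.
have c1 : #|S1| = Aseq m - 2.
  rewrite cardsDS ?card_maximal_independent ?cards2 ?Lset_neq_Rset //; first lia.
  by rewrite subUset !sub1set !inE Lset_maximal Rset_maximal.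
have c2 : #|S2| = n.
  rewrite card_imset ?card_ord // => i j e; apply: val_inj => /=.
  have : memn (dropL i) i.*2 = memn (dropL j) i.*2 by rewrite e.
  by rewrite !memnE; have := ltn_ord i; lia.
have c3 : #|S3| = n - 3.
  rewrite card_imset ?card_ord // => i j e; apply: val_inj => /=.
  have : memn (dropR i.+1) i.+1.*2.+1 = memn (dropR j.+1) i.+1.*2.+1 by rewrite e.
  by rewrite !memnE; have := ltn_ord i; lia.
have SE : [set A | maxset proper_indep A] = S1 :|: S2 :|: S3.
  apply/setP => A; rewrite inE !in_setU S1E -orbA.
  apply/idP/or3P => [/maxset_proper_indepP[]|h]; [| | |apply/maxset_proper_indepP;
    case: h].
  + by case=> mA bA; constructor 1; rewrite mA.
  + by case=> j hj ->; constructor 2; apply/imsetP; exists (Ordinal hj).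
  + case=> [[|i] [// _ hi ->]]; have hi' : i < n - 3 by lia.
    by constructor 3; apply/imsetP; exists (Ordinal hi').
  + by case/andP => mA bA; constructor 1.
  + by case/imsetP => j _ ->; constructor 2; exists j.
  + by case/imsetP => i _ ->; constructor 3; exists i.+1; split=> //;
    have := ltn_ord i; lia.
have nmax A B v : maximal_independent path B -> A \subset B -> v \in B -> v \notin A ->
    A \notin S1.
  move=> mB AB vB vA; rewrite S1E; apply/negP => /andP[mA _].
  by move: vA; rewrite -(maximal_independent_eq mA (independent_maximal mB) AB) vB.
have d12 : [disjoint S1 & S2].
  rewrite disjoint_sym; apply/pred0P => A /=; apply/negP => /andP[/imsetP[j _ ->]].
  apply/negP; have hj : j.*2 < m by have := ltn_ord j; lia.
  apply: (@nmax _ Lset (Ordinal hj)); rewrite ?Lset_maximal -?memn_val ?memnE /=; try lia.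
  by apply/memn_sub => k; rewrite !memnE => /and3P[-> ->].
have d13 : [disjoint S1 & S3].
  rewrite disjoint_sym; apply/pred0P => A /=; apply/negP => /andP[/imsetP[i _ ->]].
  apply/negP; have hi : i.+1.*2.+1 < m by have := ltn_ord i; lia.
  apply: (@nmax _ Rset (Ordinal hi)); rewrite ?Rset_maximal -?memn_val ?memnE /=; try lia.
  by apply/memn_sub => k; rewrite !memnE => /and3P[-> ->].
have d23 : [disjoint S2 & S3].
  apply/pred0P => A /=; apply/negP => /andP[/imsetP[j _ ->] /imsetP[i _ e]].
  have : memn (dropL j) 1 = memn (dropR i.+1) 1 by rewrite e.
  by rewrite !memnE; lia.
rewrite SE cardsU cardsU.
have -> : S1 :&: S2 = set0 by apply/eqP; rewrite setI_eq0.
have -> : (S1 :|: S2) :&: S3 = set0.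
  by apply/eqP; rewrite setIUl setU_eq0 !setI_eq0 d13.
by rewrite !cards0 !subn0 c1 c2 c3.
Qed.

Lemma card_maximal_subsemigroup :
  #|[set M : {set PT n} | maximal_subsemigroup (On n) M]|
  = (Aseq m - 2 + n + (n - 3)).+1.
Proof.
have -> : [set M : {set PT n} | maximal_subsemigroup (On n) M] =
          (On n :\ 1%g) |: [set IS A | A in [set A | maxset proper_indep A]].
  apply/setP => M; rewrite inE in_setU1; apply/idP/orP.
    case/(maximal_subsemigroupE hn) => [->|[A mA ->]]; [by left | right].
    by apply: imset_f; rewrite inE.
  case=> [/eqP->|/imsetP[A mA ->]]; apply/maximal_subsemigroupE => //; first by left.
  by right; exists A => //; move: mA; rewrite inE.
rewrite cardsU1 card_in_imset ?card_maxset_proper_indep.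
  suff -> : On n :\ 1%g \notin [set IS A | A in [set A | maxset proper_indep A]] by [].
  apply/imsetP => -[A _ e].
  by have := indep_subsemigroup1 hn A; rewrite -e setD11.
move=> A B; rewrite !inE => /maxsetP[gA _] /maxsetP[gB _]; exact: indep_subsemigroup_inj.
Qed.

End Classification.

Theorem theorem3p7 (n : nat) (hn : 2 <= n) :
  (forall M : {set PT n},
     maximal_subsemigroup (On n) M <->
     [\/ family_a M, family_b M, family_c M | family_d M])
  /\ (forall M : {set PT n},
        [/\ family_a M -> type_M1 (On n) M,
            family_b M -> type_M2 (On n) M,
            family_c M -> type_M3 (On n) M
          & family_d M -> type_M4 (On n) M])
  /\ (n = 2 -> #|[set M : {set PT n} | maximal_subsemigroup (On n) M]| = 3)
  /\ (3 <= n ->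
      #|[set M : {set PT n} | maximal_subsemigroup (On n) M]|
      = Aseq (2 * n - 1) + 2 * n - 4).
Proof.
split; first exact: maximal_families.
split=> [M|].
  by split; [exact: family_a_type | exact: family_b_type | exact: family_c_type |
    exact: family_d_type].
rewrite card_maximal_subsemigroup //.
(* The two one-kind maximal independent sets make the subtraction exact. *)
have A2 : 2 <= Aseq (2 * n - 1).
  rewrite -card_maximal_independent; last lia.
  apply: (@leq_trans #|[set Lset n; Rset n]|); first by rewrite cards2 Lset_neq_Rset.
  by apply: subset_leq_card; rewrite subUset !sub1set !inE Lset_maximal ?Rset_maximal.
by split=> [n2|n3]; [subst n | lia].
Qed.
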